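(* Each of the following decision problems is undecidable. The input is a finite template $(\mathbf{A},\mathbf{B})$ with $|A|\le 3$, and the question is whether the polymorphism minion $\mathrm{Pol}(\mathbf{A},\mathbf{B})$ contains: (1)(i) a cyclic polymorphism of every prime arity; (1)(ii) a cyclic polymorphism of some arity; (1)(iii) a cyclic polymorphism of every prime arity except finitely many; (1)(iv) cyclic polymorphisms of infinitely many prime arities; (2)(i) a WNU polymorphism of every arity $k\ge 3$; (2)(ii) a WNU polymorphism of some arity $k\ge 3$; (2)(iii) a WNU polymorphism of every arity $k\ge 3$ except finitely many; (2)(iv) WNU polymorphisms of infinitely many arities $k\ge 3$.
   Context: A relational signature $\Sigma$ is a finite set of relation symbols $R$, each with an arity $\mathrm{ar}(R)\in\mathbb{N}=\{1,2,\dots\}$. A $\Sigma$-structure $\mathbf{A}$ has a universe $A$ and relations $R^{A}\subseteq A^{\mathrm{ar}(R)}$. A homomorphism $h:\mathbf{A}\to\mathbf{B}$ between $\Sigma$-structures is a map $A\to B$ sending tuples of $R^A$ into $R^B$ for every $R$; write $\mathbf{A}\to\mathbf{B}$ if one exists. The $n$-th power $\mathbf{A}^n$ has universe $A^n$, and a tuple $(\mathbf{a}_1,\dots,\mathbf{a}_{\mathrm{ar}(R)})$ of elements of $A^n$ is in $R^{A^n}$ iff $(a_{1,j},\dots,a_{\mathrm{ar}(R),j})\in R^A$ for every coordinate $j\in[n]$. A finite template is a pair $(\mathbf{A},\mathbf{B})$ of finite structures of the same signature with $\mathbf{A}\to\mathbf{B}$. An $n$-ary polymorphism is a homomorphism $f:\mathbf{A}^n\to\mathbf{B}$;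 $\mathrm{Pol}(\mathbf{A},\mathbf{B})$ is the set of all polymorphisms of all arities. An $n$-ary polymorphism $f$ is cyclic if $f(b_1,\dots,b_n)=f(b_n,b_1,\dots,b_{n-1})$ for all $b_1,\dots,b_n\in A$. An $n$-ary polymorphism $f$ is a weak near-unanimity (WNU) polymorphism if for all $x,y\in A$ the value $f(x,\dots,x,y,x,\dots,x)$ (with the single $y$ in position $i$) does not depend on $i\in[n]$.
   Formalization: In (1)(ii) ''some arity'' is taken to mean some arity n ≥ 2, because every template has a unary polymorphism and every unary polymorphism is trivially cyclic, so with arity 1 allowed the answer would always be yes. *)

(* Defs.v *)
From mathcomp Require Import all_boot.

Set Implicit Arguments.
Unset Strict Implicit.
Unset Printing Implicit Defensive.

Record signature := Signature {
  sym : finType;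
  ar : sym -> nat;
  ar_gt0 : forall R, 0 < ar R
}.

Record structure (S : signature) := Structure {
  univ :> finType;
  rel_of : forall R : sym S, {set (ar R).-tuple univ}
}.

Definition homomorphism (S : signature) (A B : structure S) (h : A -> B) : Prop :=
  forall (R : sym S) (t : (ar R).-tuple A),
    t \in rel_of A R -> map_tuple h t \in rel_of B R.

Definition power (S : signature) (A : structure S) (n : nat) : structure S :=
  @Structure S (n.-tuple A : finType)
    (fun R => [set t : (ar R).-tuple (n.-tuple A) |
       [forall j : 'I_n, map_tuple (fun a => tnth a j) t \in rel_of A R]]).

Record template := Template {
  tsig : signature;
  lhs : structure tsig;
  rhs : structure tsig;
  lhs_to_rhs : exists h : lhs -> rhs, homomorphism h
}.

Definition cyclic_fun (n : nat) (A B : Type) (f : n.-tuple A -> B) : Prop :=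
  forall b : n.-tuple A, f b = f (rotr_tuple 1 b).

Definition wnu_fun (n : nat) (A B : Type) (f : n.-tuple A -> B) : Prop :=
  forall (x y : A) (i j : 'I_n),
    f [tuple if k == i then y else x | k < n] =
    f [tuple if k == j then y else x | k < n].

Definition has_cyclic (T : template) (n : nat) : Prop :=
  exists f : power (lhs T) n -> rhs T, homomorphism f /\ cyclic_fun f.

Definition has_wnu (T : template) (n : nat) : Prop :=
  exists f : power (lhs T) n -> rhs T, homomorphism f /\ wnu_fun f.

(* Kleene's partial recursive functions; [recf n] is the syntax of the n-ary
   ones and [eval f v r] means that f is defined at v with value r.           *)
Inductive recf : nat -> Type :=
| Zero n : recf n
| Succ : recf 1
| Proj n (i : 'I_n) : recf n
| Comp k n (f : recf k) (g : 'I_k -> recf n) : recf n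
| Prec n (f : recf n) (g : recf n.+2) : recf n.+1
| Mu n (f : recf n.+1) : recf n.

(* In the [Prec] case, s lists the successive values of the recursion
   s 0 = f(v), s (i+1) = g(i, s i, v). In the [Mu] case, f must be defined, and
   nonzero, at every argument below the returned one.                         *)
Fixpoint eval (n : nat) (f : recf n) : n.-tuple nat -> nat -> Prop :=
  match f in recf n return n.-tuple nat -> nat -> Prop with
  | Zero _ => fun _ r => r = 0
  | Succ => fun v r => r = (thead v).+1
  | Proj _ i => fun v r => r = tnth v i
  | Comp k _ f g => fun v r =>
      exists w : k.-tuple nat, (forall i, eval (g i) v (tnth w i)) /\ eval f w r
  | Prec _ f g => fun v r =>
      exists s : nat -> nat,
        [/\ eval f (behead_tuple v) (s 0),
            forall i, i < thead v ->
              eval g (cons_tuple i (cons_tuple (s i) (behead_tuple v))) (s i.+1)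
          & r = s (thead v)]
  | Mu _ f => fun v r =>
      eval f (cons_tuple r v) 0 /\
      forall i, i < r -> exists y, eval f (cons_tuple i v) y.+1
  end.

Definition enumerates (X : finType) (s : seq X) : Prop := uniq s /\ s =i X.

Definition code_tuples (X : finType) (s : seq X) (k : nat)
    (l : seq (k.-tuple X)) : nat :=
  CodeSeq.code [seq CodeSeq.code [seq index x s | x <- t] | t : k.-tuple X <- l].

(* The codes of T: number the symbols and the elements of the two universes in
   any order, list for each symbol its arity and the tuples of its two relations
   (in any order, repetitions allowed), and Gödel-number the resulting nested
   list by the bijection CodeSeq.code : seq nat -> nat. A code determines the
   template up to renaming of symbols and elements.                           *)
Definition encodes (T : template) (c : nat) : Prop :=
  exists (ss : seq (sym (tsig T))) (sA : seq (lhs T)) (sB : seq (rhs T))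
         (lA : forall R : sym (tsig T), seq ((ar R).-tuple (lhs T)))
         (lB : forall R : sym (tsig T), seq ((ar R).-tuple (rhs T))),
    [/\ enumerates ss, enumerates sA, enumerates sB,
        forall R, lA R =i rel_of (lhs T) R /\ lB R =i rel_of (rhs T) R
      & c = CodeSeq.code [:: size sA; size sB;
              CodeSeq.code [seq CodeSeq.code
                [:: ar R; code_tuples sA (lA R); code_tuples sB (lB R)]
                | R <- ss]]].

(* f halts with the correct answer (1 for yes, 0 for no) on every code of every
   instance; nothing is required of f on other inputs.                        *)
Definition decides (f : recf 1) (inst Q : template -> Prop) : Prop :=
  forall T : template, inst T -> forall c : nat, encodes T c ->
    exists b : bool, eval f [tuple c] b /\ (b <-> Q T).

Definition undecidable (inst Q : template -> Prop) : Prop :=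
  ~ exists f : recf 1, decides f inst Q.

Definition lhs_at_most_3 (T : template) : Prop := #|lhs T| <= 3.

(* Main.v *)
Require Import Defs.
From mathcomp Require Import all_boot zify.

(** A polymorphism of arity [n] labels the words of length [n] over {0,1,2}. The
labels of the words with [a] ones and [c] twos are made to record, for the
configuration of a register machine after [c] steps, its state and the truth
values of [a < r_i]. The local rules of this space-time diagram may only be
imposed for words differing at a single position, so the template must force
every polymorphism to recognise singletons among the words over {0,1}.

For WNUs the other sets carry the value of a dictator: disjoint sets are not
both large, unions of small sets are small, and the full set is large. If all
singletons have the same label, then this label cannot be one of these two.

For cyclic polymorphisms, a rule compares the sizes of disjoint sets; rotation
makes all singletons equal. Another rule says whether [#1] divides [#0] and is
preserved when a set as large as the set of ones is turned from two to zero;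
starting from the word with a single one and no zero it reaches the singleton.
In prime arity this divisibility characterises singletons, so that a labelling
depending only on [a] and [c] satisfies all the rules.

The machine runs a supposed decision procedure on the code of its own template.
Its input [m] is the code of all the relation symbols but one; the remaining
symbol, of arity [m + 2], fixes the initial register to [m], so that the code of
the whole template is a computable function of [m]. *)

Set Implicit Arguments.
Unset Strict Implicit.
Unset Printing Implicit Defensive.

(** * While programs for recursive functions *)

Definition upd (s : nat -> nat) (i v : nat) : nat -> nat :=
  fun j => if j == i then v else s j.

Lemma upd_same s i v : upd s i v i = v.
Proof. by rewrite /upd eqxx. Qed.

Lemma upd_other s i v j : j <> i -> upd s i v j = s j.
Proof. by rewrite /upd; case: eqP. Qed.

Inductive com :=
| Skip | Inc of nat | Dec of nat | Seq of com & com | While of nat & com.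

Inductive exec : com -> (nat -> nat) -> (nat -> nat) -> Prop :=
| exec_Skip s : exec Skip s s
| exec_Inc i s : exec (Inc i) s (upd s i (s i).+1)
| exec_Dec i s : exec (Dec i) s (upd s i (s i).-1)
| exec_Seq c1 c2 s s1 s2 : exec c1 s s1 -> exec c2 s1 s2 -> exec (Seq c1 c2) s s2
| exec_While0 i c s : s i = 0 -> exec (While i c) s s
| exec_WhileS i c s s1 s2 : s i <> 0 -> exec c s s1 ->
    exec (While i c) s1 s2 -> exec (While i c) s s2.

(** [P k] is the invariant after [k] rounds, when the counter [x] holds [N - k]; all counting loops
    below are instances. *)
Lemma exec_while_count x c (P : nat -> (nat -> nat) -> Prop) N s :
  (forall k s, k < N -> P k s -> s x = N - k ->
     exists s', [/\ exec c s s', P k.+1 s' & s' x = N - k.+1]) ->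
  P 0 s -> s x = N ->
  exists s', [/\ exec (While x c) s s', P N s' & s' x = 0].
Proof.
move=> step.
suff main : forall d k s, k + d = N -> P k s -> s x = N - k ->
    exists s', [/\ exec (While x c) s s', P N s' & s' x = 0].
  by move=> P0 sx; apply: (main N 0) => //; rewrite sx subn0.
elim=> [|d IH] k {}s kd Pk sx.
  have kN : k = N by lia.
  by exists s; split; [constructor; lia | rewrite -kN | lia].
have [|s1 [ex P1 s1x]] := step k s _ Pk sx; first by lia.
have [|s2 [ex2 P2 s2x]] := IH k.+1 s1 _ P1 s1x; first by lia.
exists s2; split=> //; apply: exec_WhileS ex ex2; lia.
Qed.

Definition clear x := While x (Dec x).

Lemma exec_clear x s :
  exists s', [/\ exec (clear x) s s', s' x = 0 & forall j, j <> x -> s' j = s j].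
Proof.
have [|||s' [ex Ps sx]] := @exec_while_count x (Dec x)
    (fun _ s' => forall j, j <> x -> s' j = s j) (s x) s.
- move=> k s1 lt_k P1 s1x; exists (upd s1 x (s1 x).-1); split=> //.
  + by constructor.
  + by move=> j jx; rewrite upd_other // P1.
  + by rewrite upd_same s1x; lia.
- by [].
- by [].
by exists s'.
Qed.

(** Registers can only be tested and changed by one, so [x] is emptied into [y] and [t] together and
    then refilled from [t]. *)
Definition copy x y t :=
  Seq (Seq (clear y) (clear t))
    (Seq (While x (Seq (Dec x) (Seq (Inc y) (Inc t))))
         (While t (Seq (Dec t) (Inc x)))).

Lemma exec_copy x y t s : x <> y -> x <> t -> y <> t ->
  exists s', [/\ exec (copy x y t) s s', s' y = s x
    & forall j, j <> y -> j <> t -> s' j = s j].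
Proof.
move=> xy xt yt.
have [s1 [ex1 s1y s1o]] := exec_clear y s.
have [s2 [ex2 s2t s2o]] := exec_clear t s1.
have s2x : s2 x = s x by rewrite s2o // s1o.
have s2y : s2 y = 0 by rewrite s2o.
have [|||s3 [ex3 [s3y s3t s3o] s3x]] :=
  @exec_while_count x (Seq (Dec x) (Seq (Inc y) (Inc t)))
   (fun k s' => [/\ s' y = k, s' t = k
      & forall j, j <> x -> j <> y -> j <> t -> s' j = s j]) (s x) s2.
- move=> k u ltk [uy ut uo] ux.
  set u1 := upd u x (u x).-1; set u2 := upd u1 y (u1 y).+1.
  exists (upd u2 t (u2 t).+1); split.
  + by do 2?[apply: exec_Seq; first by constructor]; constructor.
  + split.
    * by rewrite upd_other // /u2 upd_same /u1 upd_other ?uy //; apply/nesym.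
    * by rewrite upd_same /u2 /u1 !upd_other ?ut //; apply/nesym.
    * by move=> j jx jy jt; rewrite upd_other // /u2 upd_other // /u1 upd_other // uo.
  + by rewrite upd_other // /u2 upd_other // /u1 upd_same ux; lia.
- by split=> // j jx jy jt; rewrite s2o // s1o.
- by [].
have [|||s4 [ex4 [s4x s4y s4o] s4t]] :=
  @exec_while_count t (Seq (Dec t) (Inc x))
   (fun k s' => [/\ s' x = k, s' y = s x
      & forall j, j <> x -> j <> y -> j <> t -> s' j = s j]) (s x) s3.
- move=> k u ltk [ux uy uo] ut.
  set u1 := upd u t (u t).-1.
  exists (upd u1 x (u1 x).+1); split.
  + by apply: exec_Seq; constructor.
  + split.
    * by rewrite upd_same /u1 upd_other // ux.
    * by rewrite upd_other /u1 ?upd_other ?uy //; apply/nesym.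
    * by move=> j jx jy jt; rewrite upd_other // /u1 upd_other // uo.
  + by rewrite upd_other /u1 ?upd_same ?ut; [lia | apply/nesym].
- by [].
- by [].
exists s4; split=> //.
- by apply: exec_Seq; [apply: exec_Seq ex1 ex2 | apply: exec_Seq ex3 ex4].
- move=> j jy jt; have [->|/eqP jx] := eqVneq j x; first by rewrite s4x.
  exact: s4o.
Qed.

Definition fcons n (x : nat) (v : 'I_n -> nat) : 'I_n.+1 -> nat :=
  fun i => if unlift ord0 i is Some j then v j else x.

Definition read n (s : nat -> nat) (v : 'I_n -> nat) : n.-tuple nat :=
  [tuple s (v i) | i < n].

Lemma read_fcons n s x (v : 'I_n -> nat) :
  read s (fcons x v) = cons_tuple (s x) (read s v).
Proof.
apply: eq_from_tnth => i; rewrite tnth_mktuple /fcons.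
case: unliftP => [j ->|->]; last by rewrite tnth0.
by rewrite tnthS tnth_mktuple.
Qed.

Lemma read_head n s (v : 'I_n.+1 -> nat) : thead (read s v) = s (v ord0).
Proof. by rewrite /thead tnth_mktuple. Qed.

Lemma read_behead n s (v : 'I_n.+1 -> nat) :
  behead_tuple (read s v) = read s (v \o lift ord0).
Proof.
apply: eq_from_tnth => i.
by rewrite tnth_behead !tnth_mktuple /=; congr (s (v _)); apply: val_inj;
   rewrite /= inordK // ltnS.
Qed.

Lemma eq_read n s s' (v : 'I_n -> nat) :
  (forall i, s (v i) = s' (v i)) -> read s v = read s' v.
Proof. by move=> E; apply: eq_from_tnth => i; rewrite !tnth_mktuple. Qed.

(** Registers below [z], except the target [d], are protected; those from [z] on are scratch space.
    Nothing is claimed where [f] is undefined. *)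
Definition computes n (f : recf n) (v : 'I_n -> nat) (d z : nat) (c : com) : Prop :=
  forall s r, eval f (read s v) r ->
    exists s', [/\ exec c s s', s' d = r
      & forall j, j < z -> j <> d -> s' j = s j].

(** The layout is universally quantified, so that a surrounding program can choose where arguments,
    target and scratch space of a subprogram lie. As the target is not an argument, the arguments
    survive. *)
Definition compilable n (f : recf n) : Prop :=
  forall (v : 'I_n -> nat) d z, (forall i, v i < z) -> d < z ->
    (forall i, v i <> d) -> exists c, computes f v d z c.

(** The values of the [g i] are collected in the registers [z] to [z + k - 1], with the scratch
    space of the subprograms moved up to [z + k]. *)
Lemma compilable_Comp k n (f : recf k) (g : 'I_k -> recf n) :
  compilable f -> (forall i, compilable (g i)) -> compilable (Comp f g).
Proof.
move=> Cf Cg v d z vz dz vd.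
have args : forall j, j <= k -> exists c, forall s (w : k.-tuple nat),
    (forall i, eval (g i) (read s v) (tnth w i)) ->
    exists s', [/\ exec c s s',
       forall i : 'I_k, i < j -> s' (z + i) = tnth w i
     & forall l, l < z -> s' l = s l].
  elim=> [|j IH] ltj.
    by exists Skip => s w _; exists s; split=> //; constructor.
  have [c Hc] := IH (ltnW ltj).
  pose i0 := Ordinal ltj.
  have [||| c' Hc'] := Cg i0 v (z + j) (z + k).
  - by move=> i; rewrite ltn_addr.
  - by rewrite ltn_add2l.
  - by move=> i; have := vz i; lia.
  exists (Seq c c') => s w Hw.
  have [s1 [ex1 r1 o1]] := Hc s w Hw.
  have [|s2 [ex2 r2 o2]] := Hc' s1 (tnth w i0).
    by rewrite (@eq_read _ s1 s) // => i; rewrite o1.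
  exists s2; split.
  - exact: exec_Seq ex1 ex2.
  - move=> i; rewrite ltnS leq_eqVlt => /orP[/eqP ij|ij].
      by rewrite ij r2; congr tnth; apply: val_inj.
    rewrite o2 ?r1 ?ltn_add2l //; lia.
  - by move=> l lz; rewrite o2 ?o1 //; lia.
have [c Hc] := args k (leqnn k).
have [||| c' Hc'] := Cf (fun i : 'I_k => z + i) d (z + k).
- by move=> i; rewrite ltn_add2l.
- by rewrite ltn_addr.
- by move=> i; lia.
exists (Seq c c') => s r [w [Hw Hr]].
have [s1 [ex1 r1 o1]] := Hc s w Hw.
have [|s2 [ex2 r2 o2]] := Hc' s1 r.
  suff -> : read s1 (fun i : 'I_k => z + i) = w by [].
  by apply: eq_from_tnth => i; rewrite tnth_mktuple r1.
exists s2; split=> //; first exact: exec_Seq ex1 ex2.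
by move=> j jz jd; rewrite o2 ?o1 //; lia.
Qed.

(** Index [i], current value [a], number [x] of rounds left, next value [b] and a temporary [t]
    occupy the five registers from [z] on. *)
Lemma compilable_Prec n (f : recf n) (g : recf n.+2) :
  compilable f -> compilable g -> compilable (Prec f g).
Proof.
move=> Cf Cg v d z vz dz vd.
pose vt := v \o lift ord0.
have [i iE] : exists i, i = z by exists z.
have [a aE] : exists a, a = z.+1 by exists z.+1.
have [x xE] : exists x, x = z.+2 by exists z.+2.
have [b bE] : exists b, b = z.+3 by exists z.+3.
have [t tE] : exists t, t = z.+4 by exists z.+4.
have [||| cf Hf] := Cf vt a z.+4.+1; try lia.
  by move=> j; have := vz (lift ord0 j); rewrite /vt /=; lia.
  by move=> j; have := vz (lift ord0 j); rewrite /vt /=; lia.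
have [||| cg Hg] := Cg (fcons i (fcons a vt)) b z.+4.+1; try lia.
  move=> j; rewrite /fcons; case: (unlift _ _) => [j'|]; last by lia.
  case: (unlift _ _) => [j''|]; last by lia.
  by have := vz (lift ord0 j''); rewrite /vt /=; lia.
  move=> j; rewrite /fcons; case: (unlift _ _) => [j'|]; last by lia.
  case: (unlift _ _) => [j''|]; last by lia.
  by have := vz (lift ord0 j''); rewrite /vt /=; lia.
pose body := Seq (Dec x) (Seq cg (Seq (copy b a t) (Inc i))).
exists (Seq (Seq cf (Seq (clear i) (copy (v ord0) x t)))
            (Seq (While x body) (copy a d t))) => s r [sq [H0 HS Hr]].
have v0z := vz ord0.
have [|s1 [ex1 r1 o1]] := Hf s (sq 0); first by rewrite -read_behead.
have [s2 [ex2 r2 o2]] := exec_clear i s1.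
have [|||s3 [ex3 r3 o3]] := @exec_copy (v ord0) x t s2; try lia.
rewrite read_head in HS Hr.
pose N := s (v ord0).
have s3x : s3 x = N by rewrite r3 o2 ?o1 //; lia.
have [||s4 [ex4 [s4i s4a s4o] s4x]] := @exec_while_count x body
  (fun k u => [/\ u i = k, u a = sq k & forall j, j < z -> u j = s j]) N s3 _ _ s3x.
- move=> k u ltk [ui ua uo] ux.
  pose u1 := upd u x (u x).-1.
  have [|u2 [eu2 ru2 ou2]] := Hg u1 (sq k.+1).
    rewrite !read_fcons; have := HS k ltk; rewrite read_behead -/vt.
    suff [-> -> ->] : [/\ u1 i = k, u1 a = sq k & read u1 vt = read s vt] by [].
    split; rewrite /u1 ?upd_other //; try lia.
    apply: eq_read => j; rewrite upd_other; first by rewrite uo // vz.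
    by have := vz (lift ord0 j); rewrite /vt /=; lia.
  have [|||u3 [eu3 ru3 ou3]] := @exec_copy b a t u2; try lia.
  have u3i : u3 i = k.
    by rewrite ou3 ?ou2 /u1 ?upd_other; lia.
  exists (upd u3 i (u3 i).+1); split.
  + apply: exec_Seq; first by constructor.
    by apply: exec_Seq eu2 _; apply: exec_Seq eu3 _; constructor.
  + split; first by rewrite upd_same u3i.
    * by rewrite upd_other ?ru3 ?ru2 //; lia.
    * move=> j jz; rewrite upd_other ?ou3 ?ou2 /u1 ?upd_other ?uo //;
      lia.
  + by rewrite upd_other ?ou3 ?ou2 /u1 ?upd_same ?ux; lia.
- split.
  + by rewrite o3 ?r2; lia.
  + by rewrite o3 ?o2 ?r1; lia.
  + by move=> j jz; rewrite o3 ?o2 ?o1; lia.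
have [|||s5 [ex5 r5 o5]] := @exec_copy a d t s4; try lia.
exists s5; split.
- apply: exec_Seq; first by apply: exec_Seq ex1 _; apply: exec_Seq ex2 ex3.
  exact: exec_Seq ex4 ex5.
- by rewrite r5 s4a Hr.
- by move=> j jz jd; rewrite o5 ?s4o //; lia.
Qed.

(** Register [i] holds the candidate and [b] the value of [f] there; [i] is raised until [b] is
    zero. Each round terminates because [f] is defined up to [r]. *)
Lemma compilable_Mu n (f : recf n.+1) : compilable f -> compilable (Mu f).
Proof.
move=> Cf v d z vz dz vd.
have [i iE] : exists i, i = z by exists z.
have [b bE] : exists b, b = z.+1 by exists z.+1.
have [t tE] : exists t, t = z.+2 by exists z.+2.
have [||| cf Hf] := Cf (fcons i v) b z.+3; try lia.
  move=> j; rewrite /fcons; case: (unlift _ _) => [j'|]; last by lia.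
  by have := vz j'; lia.
  move=> j; rewrite /fcons; case: (unlift _ _) => [j'|]; last by lia.
  by have := vz j'; lia.
exists (Seq (Seq (clear i) cf)
         (Seq (While b (Seq (Inc i) cf)) (copy i d t))) => s r [Hr Hlt].
have run u k y : k <= r -> u i = k -> (forall j, j < z -> u j = s j) ->
    eval f (cons_tuple k (read s v)) y ->
    exists u', [/\ exec cf u u', u' b = y, u' i = k & forall j, j < z -> u' j = s j].
  move=> kr ui uo ev; have [|u' [eu ru ou]] := Hf u y.
    rewrite read_fcons ui (@eq_read _ u s) // => j; exact: uo.
  exists u'; split=> //; first by rewrite ou ?ui; lia.
  by move=> j jz; rewrite ou ?uo //; lia.
(* [e] counts the candidates left before [r]; the tested register vanishes exactly when [e] does. *)
have loop : forall e k u, k + e = r -> u i = k -> (forall j, j < z -> u j = s j) ->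
    eval f (cons_tuple k (read s v)) (u b) ->
    (e = 0 -> u b = 0) -> (0 < e -> u b <> 0) ->
    exists u', [/\ exec (While b (Seq (Inc i) cf)) u u', u' i = r
      & forall j, j < z -> u' j = s j].
  elim=> [|e IH] k u ke ui uo ev u0 uS.
    by exists u; split=> //; [constructor; exact: u0 | lia].
  have [y [evy y0 yS]] : exists y, [/\ eval f (cons_tuple k.+1 (read s v)) y,
      (e = 0 -> y = 0) & (0 < e -> y <> 0)].
    case: e {IH} ke uS u0 => [|e] ke uS u0.
      exists 0; split=> //; suff -> : k.+1 = r by []. lia.
    by have [|y Hy] := Hlt k.+1; [lia | exists y.+1].
  have [||||u' [eu ru ui' uo']] := run (upd u i (u i).+1) k.+1 y; try done.
  - lia.
  - by rewrite upd_same ui.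
  - by move=> j jz; rewrite upd_other ?uo //; lia.
  have [||||||u'' [eu2 r2 o2]] := IH k.+1 u'; rewrite ?ru //; first by lia.
  exists u''; split=> //; apply: (exec_WhileS (s1 := u')) => //.
    exact: uS.
  by apply: exec_Seq eu; constructor.
have [s1 [ex1 r1 o1]] := exec_clear i s.
have [y [evy y0 yS]] : exists y, [/\ eval f (cons_tuple 0 (read s v)) y,
    (r = 0 -> y = 0) & (0 < r -> y <> 0)].
  case: (posnP r) => [r0|r0]; first by exists 0; split=> //; move: Hr; rewrite r0.
  by have [y Hy] := Hlt 0 r0; exists y.+1; split=> // ; lia.
have [||||s2 [ex2 r2 i2 o2]] := run s1 0 y; try done.
  by move=> j jz; rewrite o1 //; lia.
have [||||||s3 [ex3 r3 o3]] := loop r 0 s2; rewrite ?r2 //.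
have [|||s4 [ex4 r4 o4]] := @exec_copy i d t s3; try lia.
exists s4; split.
- by apply: exec_Seq; [apply: exec_Seq ex1 ex2 | apply: exec_Seq ex3 ex4].
- by rewrite r4.
- by move=> j jz jd; rewrite o4 ?o3 //; lia.
Qed.

Lemma recf_compilable n (f : recf n) : compilable f.
Proof.
elim: f => {n} [n|| n i | k n f IHf g IHg | n f IHf g IHg | n f IHf].
- move=> v d z vz dz vd; exists (clear d) => s r /= ->.
  by have [s' [ex rd o]] := exec_clear d s; exists s'; split=> // j _; exact: o.
- move=> v d z vz dz vd; have v0 := vz ord0; have vd0 := vd ord0.
  exists (Seq (copy (v ord0) d z) (Inc d)) => s r /= ->.
  have [|||s' [ex rd o]] := @exec_copy (v ord0) d z s; try lia.
  exists (upd s' d (s' d).+1); split; first by apply: exec_Seq ex _; constructor.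
    by rewrite upd_same rd read_head.
  by move=> j jz jd; rewrite upd_other // o //; lia.
- move=> v d z vz dz vd; have v0 := vz i; have vd0 := vd i.
  exists (copy (v i) d z) => s r /= ->.
  have [|||s' [ex rd o]] := @exec_copy (v i) d z s; try lia.
  exists s'; split=> //; first by rewrite rd tnth_mktuple.
  by move=> j jz jd; rewrite o //; lia.
- exact: compilable_Comp.
- exact: compilable_Prec.
- exact: compilable_Mu.
Qed.

(** * Register machines *)

Inductive act := Up | Down | Keep.

Definition act_fun (a : act) (v : nat) : nat :=
  match a with Up => v.+1 | Down => v.-1 | Keep => v end.

(* [(i, a, z, nz)]: apply [a] to register [i], then jump to [z] if the register
   was zero and to [nz] otherwise. *)
Definition instr := (nat * act * nat * nat)%type.

Definition noop : instr := (0, Keep, 0, 0).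

(** [Keep] returns the same store instead of updating a register with its own value, since
    [exec_code] compares stores by equality of functions. *)
Definition gstep (cd : seq instr) (x : nat * (nat -> nat)) :=
  let: (i, a, z, nz) := nth noop cd x.1 in
  (if x.2 i == 0 then z else nz,
   if a is Keep then x.2 else upd x.2 i (act_fun a (x.2 i))).

Fixpoint len (c : com) : nat :=
  match c with
  | Skip => 0
  | Inc _ | Dec _ => 1
  | Seq c1 c2 => len c1 + len c2
  | While _ c => (len c).+2
  end.

Fixpoint code (p : nat) (c : com) : seq instr :=
  match c with
  | Skip => [::]
  | Inc i => [:: (i, Up, p.+1, p.+1)]
  | Dec i => [:: (i, Down, p.+1, p.+1)]
  | Seq c1 c2 => code p c1 ++ code (p + len c1) c2
  | While i c =>
      (i, Keep, p + (len c).+2, p.+1) :: rcons (code p.+1 c) (0, Keep, p, p)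
  end.

Lemma size_code c p : size (code p c) = len c.
Proof.
elim: c p => //= [c1 IH1 c2 IH2 | i c IH] p; first by rewrite size_cat IH1 IH2.
by rewrite size_rcons IH.
Qed.

(** Arbitrary surrounding code [pre] and [post] lets the induction enter subprograms, whose jump
    targets are absolute addresses. *)
Lemma exec_code c s s' : exec c s s' ->
  forall pre post cd, cd = pre ++ code (size pre) c ++ post ->
  exists k, iter k (gstep cd) (size pre, s) = (size pre + len c, s').
Proof.
elim=> {c s s'} [s | i s | i s | c1 c2 s s1 s2 _ IH1 _ IH2 | i c s s0
                | i c s s1 s2 s0 _ IH1 _ IH2] pre post cd E.
- by exists 0; rewrite /= addn0.
- exists 1; rewrite /= /gstep /= E nth_cat ltnn subnn /= addn1; by case: ifP.
- exists 1; rewrite /= /gstep /= E nth_cat ltnn subnn /= addn1; by case: ifP.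
- have [|k1 E1] := IH1 pre (code (size pre + len c1) c2 ++ post) cd.
    by rewrite E /= !catA.
  have [|k2 E2] := IH2 (pre ++ code (size pre) c1) post cd.
    by rewrite E /= size_cat size_code !catA.
  rewrite size_cat size_code in E2.
  by exists (k2 + k1); rewrite iterD E1 E2 /= addnA.
- by exists 1; rewrite /= /gstep /= E nth_cat ltnn subnn /= s0 eqxx.
- have [|k1 E1] := IH1 (rcons pre (i, Keep, size pre + (len c).+2, (size pre).+1))
      ((0, Keep, size pre, size pre) :: post) cd.
    by rewrite E /= size_rcons cat_rcons /= cat_rcons.
  have [k2 E2] := IH2 pre post cd E.
  exists (k2 + (1 + (k1 + 1))); rewrite !iterD.
  have -> : iter 1 (gstep cd) (size pre, s) = ((size pre).+1, s).
    by rewrite /= /gstep /= E nth_cat ltnn subnn /=; case: eqP s0.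
  rewrite size_rcons in E1; rewrite E1.
  have -> : iter 1 (gstep cd) ((size pre).+1 + len c, s1) = (size pre, s1).
    have -> : (size pre).+1 + len c = size pre + (len c).+1 by lia.
    rewrite /= /gstep /= E nth_cat ltnNge leq_addr addKn /=.
    by rewrite nth_cat size_rcons size_code ltnSn nth_rcons size_code ltnn eqxx /= if_same.
  exact: E2.
Qed.

(** * Machines with finite sets of states and registers *)

Record machine := Machine {
  mQ : finType;
  mI : finType;
  mprog : mQ -> mI * act * mQ * mQ;
  mstart : mQ;
  mZ : mQ;
  mN : mQ;
  minp : mI
}.

Definition mstep (M : machine) (x : mQ M * (mI M -> nat)) : mQ M * (mI M -> nat) :=
  let: (i, a, z, nz) := mprog x.1 in
  (if x.2 i == 0 then z else nz,
   fun j => if j == i then act_fun a (x.2 j) else x.2 j).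

Definition run (M : machine) (m t : nat) :=
  iter t (@mstep M) (mstart M, fun j => if j == minp M then m else 0).

Definition absorbing (M : machine) (q : mQ M) : Prop :=
  forall r, (mstep (q, r)).1 = q.

(** Output zero leads to [mZ] and nonzero to [mN]; absorption keeps the answer visible at all later
    times. The condition on [mstart] serves the homomorphism from A to B. *)
Definition decider_machine (F : recf 1) (M : machine) : Prop :=
  [/\ mZ M != mN M, mstart M != mN M, absorbing (mZ M), absorbing (mN M)
    & forall m r, eval F [tuple m] r ->
        exists t, (run M m t).1 = if r == 0 then mZ M else mN M].

(** The code for [F] is followed by a test of its output register 1 and two self-loops. It mentions
    finitely many registers and addresses, so bounds [K] and [S] on them make both sets finite. *)
Lemma recf_machine (F : recf 1) : exists M, decider_machine F M.
Proof.
have [||| c Hc] := @recf_compilable 1 F (fun _ => 0) 1 2; try done.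
pose L := len c.
pose cd := code 0 c ++
  [:: (1, Keep, L.+1, L.+2); (0, Keep, L.+1, L.+1); (0, Keep, L.+2, L.+2)].
pose K := \max_(k < size cd) (nth noop cd k).1.1.1.
pose S := maxn L.+2 (\max_(k < size cd) maxn (nth noop cd k).1.2 (nth noop cd k).2).
pose pr (q : 'I_S.+1) : 'I_K.+1 * act * 'I_S.+1 * 'I_S.+1 :=
  let: (i, a, z, nz) := nth noop cd q in (inord i, a, inord z, inord nz).
pose M := @Machine 'I_S.+1 'I_K.+1 pr ord0 (inord L.+1) (inord L.+2) ord0.
(* Addresses past the end read as [noop], whose components are zero, so the bounds hold for every
   [p]. *)
have bounds p : let: (i, a, z, nz) := nth noop cd p in [/\ i <= K, z <= S & nz <= S].
  have [lt_p|ge_p] := ltnP p (size cd); last by rewrite nth_default.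
  have iK : (nth noop cd (Ordinal lt_p)).1.1.1 <= K.
    exact: (@leq_bigmax _ (fun k : 'I_(size cd) => (nth noop cd k).1.1.1)).
  have tS : maxn (nth noop cd (Ordinal lt_p)).1.2 (nth noop cd (Ordinal lt_p)).2 <= S.
    rewrite leq_max; apply/orP; right.
    exact: (@leq_bigmax _ (fun k : 'I_(size cd) => maxn (nth noop cd k).1.2 (nth noop cd k).2)).
  move: iK tS => /=; case: (nth _ _ _) => [[[i a] z] nz] /= iK.
  by rewrite geq_max => /andP[].
pose sim (x : nat * (nat -> nat)) (y : mQ M * (mI M -> nat)) :=
  x.1 = y.1 /\ forall j : 'I_K.+1, x.2 j = y.2 j.
have sim_step x y : sim x y -> sim (gstep cd x) (mstep y).
  case: x y => [p s] [q r] [/= pq sr]; rewrite /sim /gstep /mstep /= /pr -pq.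
  have := bounds p; case: (nth _ _ _) => [[[i a] z] nz] [iK zS nzS] /=.
  split; first by rewrite -sr inordK //; case: ifP; rewrite inordK.
  move=> j; rewrite -val_eqE /= inordK // -sr.
  by case: a => //=; rewrite /upd; case: eqP => // ->.
have sim_iter k x y : sim x y -> sim (iter k (gstep cd) x) (iter k (@mstep M) y).
  by elim: k => //= k IH /IH; exact: sim_step.
have nthL k : k < 3 -> nth noop cd (L + k) = nth noop
    [:: (1, Keep, L.+1, L.+2); (0, Keep, L.+1, L.+1); (0, Keep, L.+2, L.+2)] k.
  by move=> _; rewrite nth_cat size_code ltnNge leq_addr addKn.
have nth1 := nthL 1 isT; have nth2 := nthL 2 isT.
rewrite addn1 /= in nth1; rewrite addn2 /= in nth2.
have LS : L.+2 <= S by rewrite leq_maxl.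
exists M; split.
- by rewrite -val_eqE /= !inordK //; lia.
- by rewrite -val_eqE /= inordK.
- move=> r; rewrite /mstep /= /pr inordK; last by lia.
  by rewrite nth1 /= if_same.
- move=> r; rewrite /mstep /= /pr inordK; last by lia.
  by rewrite nth2 /= if_same.
move=> m r ev.
pose s0 (j : nat) := if j == 0 then m else 0.
have [|s1 [ex r1 _]] := Hc s0 r.
  suff -> : read s0 (fun _ : 'I_1 => 0) = [tuple m] by [].
  by apply: eq_from_tnth => i; rewrite tnth_mktuple ord1.
have [|k Ek] := @exec_code _ _ _ ex [::] (drop (size (code 0 c)) cd) cd.
  by rewrite /cd drop_size_cat.
have [|E1 _] := sim_iter k.+1 (0, s0) (mstart M, fun j => if j == minp M then m else 0).
  by split=> // j; rewrite -val_eqE.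
exists k.+1; apply: ord_inj; apply: etrans (esym E1) _; rewrite iterS Ek /gstep add0n /=.
have := nthL 0 isT; rewrite addn0 -/L => -> /=; rewrite r1.
by case: ifP => _; rewrite /= inordK //; lia.
Qed.

(** * Computability of the code of the template *)

Definition computable n (F : n.-tuple nat -> nat) : Prop :=
  exists f : recf n, forall v, eval f v (F v).

Lemma eq_computable n (F F' : n.-tuple nat -> nat) :
  F =1 F' -> computable F -> computable F'.
Proof. by move=> E [f Hf]; exists f => v; rewrite -E. Qed.

Lemma computable_tnth n (i : 'I_n) : computable (fun v : n.-tuple nat => tnth v i).
Proof. by exists (Proj i). Qed.

Lemma computable_comp k n (F : k.-tuple nat -> nat)
    (G : 'I_k -> n.-tuple nat -> nat) :
  computable F -> (forall i, computable (G i)) ->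
  computable (fun v => F [tuple G i v | i < k]).
Proof.
(* The finitely many programs are chosen by induction on [k], which needs no choice axiom. *)
move=> [f Hf] HG; have [g Hg] : exists g : 'I_k -> recf n, forall i v, eval (g i) v (G i v).
  elim: k {F f Hf} G HG => [|k IH] G HG.
    by exists (fun _ => Zero n) => -[].
  have [g0 H0] := HG ord0.
  have [g Hg] := IH (fun i => G (lift ord0 i)) (fun i => HG _).
  exists (fun i => if unlift ord0 i is Some j then g j else g0) => i v.
  by case: unliftP => [j ->|->].
exists (Comp f g) => v; exists [tuple G i v | i < k]; split=> // i.
by rewrite tnth_mktuple.
Qed.

Lemma thead_cons n (x : nat) (v : n.-tuple nat) : thead (cons_tuple x v) = x.
Proof. by rewrite /thead tnth0. Qed.

Lemma behead_cons n (x : nat) (v : n.-tuple nat) : behead_tuple (cons_tuple x v) = v.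
Proof. exact: val_inj. Qed.

Lemma computable_comp_cons n k (F : n.+1.-tuple nat -> nat) (H : k.-tuple nat -> nat)
    (P : k.-tuple nat -> n.-tuple nat) :
  computable F -> computable H -> (forall i, computable (fun w => tnth (P w) i)) ->
  computable (fun w => F (cons_tuple (H w) (P w))).
Proof.
move=> CF CH CP.
have [|f Hf] := @computable_comp n.+1 k F (fun i w => tnth (cons_tuple (H w) (P w)) i) CF.
  move=> i; case: (unliftP ord0 i) => [j ->|->].
    by apply: eq_computable (CP j) => w; rewrite tnthS.
  by apply: eq_computable CH => w; rewrite tnth0.
exists f => w; have := Hf w; congr (eval _ _ (F _)).
by apply: eq_from_tnth => i; rewrite tnth_mktuple.
Qed.

Lemma computable_behead n (F : n.-tuple nat -> nat) :
  computable F -> computable (fun w : n.+1.-tuple nat => F (behead_tuple w)).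
Proof.
move=> CF; have := computable_comp CF (fun i => computable_tnth (lift (ord0 : 'I_n.+1) i)).
apply: eq_computable => w; congr F; apply: eq_from_tnth => i.
rewrite tnth_mktuple tnth_behead; congr tnth; apply: val_inj.
by rewrite /= inordK // ltnS.
Qed.

Lemma computable_var0 n : computable (fun v : n.+1.-tuple nat => thead v).
Proof. exact: computable_tnth. Qed.

Lemma computable_var1 n :
  computable (fun v : n.+2.-tuple nat => thead (behead_tuple v)).
Proof. exact: (computable_behead (computable_var0 n)). Qed.

Lemma computable_var2 n :
  computable (fun v : n.+3.-tuple nat => thead (behead_tuple (behead_tuple v))).
Proof. exact: (computable_behead (computable_var1 n)). Qed.

Lemma computable_succ n (F : n.-tuple nat -> nat) :
  computable F -> computable (fun v => (F v).+1).
Proof.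
move=> CF; have Cs : computable (fun v : 1.-tuple nat => (thead v).+1).
  by exists Succ.
have := computable_comp Cs (fun _ : 'I_1 => CF).
by apply: eq_computable => v; rewrite /thead tnth_mktuple.
Qed.

Lemma computable_const n k : computable (fun _ : n.-tuple nat => k).
Proof. by elim: k => [|k IH]; [exists (Zero n) | exact: computable_succ IH]. Qed.

Lemma computable_rec n (B C : n.-tuple nat -> nat)
    (S : nat -> nat -> n.-tuple nat -> nat) :
  computable B -> computable C ->
  computable (fun w : n.+2.-tuple nat =>
    S (thead w) (thead (behead_tuple w)) (behead_tuple (behead_tuple w))) ->
  computable (fun v => nat_rect (fun _ => nat) (B v) (fun i a => S i a v) (C v)).
Proof.
move=> [b Hb] CC [s Hs].
pose R (w : n.+1.-tuple nat) := nat_rect (fun _ => nat) (B (behead_tuple w))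
  (fun i a => S i a (behead_tuple w)) (thead w).
have CR : @computable n.+1 R.
  exists (Prec b s) => w.
  exists (nat_rect (fun _ => nat) (B (behead_tuple w)) (fun i a => S i a (behead_tuple w))).
  split=> // i _; have := Hs (cons_tuple i (cons_tuple
    (nat_rect (fun _ => nat) (B (behead_tuple w))
       (fun i a => S i a (behead_tuple w)) i) (behead_tuple w))).
  by rewrite !(thead_cons, behead_cons).
have := computable_comp_cons CR CC (@computable_tnth n).
by apply: eq_computable => v; rewrite /R thead_cons behead_cons.
Qed.

Section ComputableOps.
Variables (n : nat) (F G : n.-tuple nat -> nat).
Hypotheses (CF : computable F) (CG : computable G).

Lemma computable_add : computable (fun v => F v + G v).
Proof.
have := @computable_rec n F G (fun _ a _ => a.+1) CF CG (computable_succ (computable_var1 _)).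
by apply: eq_computable => v; elim: (G v) => [|k IH]; rewrite ?addn0 ?addnS //= IH.
Qed.

Lemma computable_pred : computable (fun v => (F v).-1).
Proof.
have := @computable_rec n (fun _ => 0) F (fun i _ _ => i) (computable_const _ _) CF
  (computable_var0 _).
by apply: eq_computable => v; case: (F v).
Qed.
End ComputableOps.

Lemma computable_sub n (F G : n.-tuple nat -> nat) :
  computable F -> computable G -> computable (fun v => F v - G v).
Proof.
move=> CF CG.
have := @computable_rec n F G (fun _ a _ => a.-1) CF CG (computable_pred (computable_var1 _)).
by apply: eq_computable => v; elim: (G v) => [|k IH]; rewrite ?subn0 ?subnS //= IH.
Qed.

Lemma computable_mul n (F G : n.-tuple nat -> nat) :
  computable F -> computable G -> computable (fun v => F v * G v).
Proof.
move=> CF CG; have := @computable_rec n (fun _ => 0) G (fun _ a v => F v + a)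
  (computable_const _ _) CG
  (computable_add (computable_behead (computable_behead CF)) (computable_var1 _)).
by apply: eq_computable => v; elim: (G v) => [|k IH]; rewrite ?muln0 ?mulnS //= IH.
Qed.

Lemma computable_exp2 n (F : n.-tuple nat -> nat) :
  computable F -> computable (fun v => 2 ^ F v).
Proof.
move=> CF; have := @computable_rec n (fun _ => 1) F (fun _ a v => 2 * a)
  (computable_const _ _) CF (computable_mul (computable_const _ _) (computable_var1 _)).
by apply: eq_computable => v; elim: (F v) => [|k IH]; rewrite ?expnS //= IH.
Qed.

Lemma computable_leq n (F G : n.-tuple nat -> nat) :
  computable F -> computable G -> computable (fun v => (F v <= G v : nat)).
Proof.
move=> CF CG; have := computable_sub (computable_const n 1) (computable_sub CF CG).
by apply: eq_computable => v; rewrite /leq; case: (F v - G v).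
Qed.

Lemma computable_and n (p q : n.-tuple nat -> bool) :
  computable (fun v => (p v : nat)) -> computable (fun v => (q v : nat)) ->
  computable (fun v => (p v && q v : nat)).
Proof.
by move=> Cp Cq; have := computable_mul Cp Cq; apply: eq_computable => v; rewrite mulnb.
Qed.

Lemma computable_neg n (p : n.-tuple nat -> bool) :
  computable (fun v => (p v : nat)) -> computable (fun v => (~~ p v : nat)).
Proof.
move=> Cp; have := computable_sub (computable_const n 1) Cp.
by apply: eq_computable => v; case: (p v).
Qed.

Lemma computable_or n (p q : n.-tuple nat -> bool) :
  computable (fun v => (p v : nat)) -> computable (fun v => (q v : nat)) ->
  computable (fun v => (p v || q v : nat)).
Proof.
move=> Cp Cq.
have := computable_neg (computable_and (computable_neg Cp) (computable_neg Cq)).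
by apply: eq_computable => v; rewrite negb_and !negbK.
Qed.

Lemma computable_eq n (F G : n.-tuple nat -> nat) :
  computable F -> computable G -> computable (fun v => (F v == G v : nat)).
Proof.
move=> CF CG.
have := computable_and (computable_leq CF CG) (computable_leq CG CF).
by apply: eq_computable => v; rewrite eqn_leq.
Qed.

Lemma computable_if n (p : n.-tuple nat -> bool) (F G : n.-tuple nat -> nat) :
  computable (fun v => (p v : nat)) -> computable F -> computable G ->
  computable (fun v => if p v then F v else G v).
Proof.
move=> Cp CF CG.
have := computable_add (computable_mul Cp CF) (computable_mul (computable_neg Cp) CG).
by apply: eq_computable => v; case: (p v); rewrite /= ?mul1n ?mul0n ?addn0.
Qed.

Lemma computable_sum n (h : nat -> n.-tuple nat -> nat) (C : n.-tuple nat -> nat) :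
  computable (fun w : n.+1.-tuple nat => h (thead w) (behead_tuple w)) ->
  computable C -> computable (fun v => \sum_(i < C v) h i v).
Proof.
move=> Ch CC.
have Ch' : computable (fun w : n.+2.-tuple nat =>
    h (thead w) (behead_tuple (behead_tuple w))).
  have [|f Hf] := @computable_comp_cons n n.+2 _ _
    (fun w => behead_tuple (behead_tuple w)) Ch (computable_var0 n.+1).
    by move=> i; exact: computable_behead (computable_behead (computable_tnth i)).
  by exists f => w; have := Hf w; rewrite thead_cons behead_cons.
have := @computable_rec n (fun _ => 0) C (fun i a v => a + h i v)
  (computable_const _ _) CC (computable_add (computable_var1 _) Ch').
apply: eq_computable => v; elim: (C v) => [|k IH]; first by rewrite big_ord0.
by rewrite big_ord_recr /= IH.
Qed.

(** The quotient counts the positive multiples of [d] up to [k]; this turns division into a bounded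
    sum of computable terms. *)
Lemma divn_sum d k : 0 < d -> \sum_(i < k) (i.+1 * d <= k : nat) = k %/ d.
Proof.
move=> d0; have -> : \sum_(i < k) (i.+1 * d <= k : nat) = \sum_(i < k) (i < k %/ d : nat).
  by apply: eq_bigr => i _; rewrite leq_divRL.
have le : k %/ d <= k by rewrite leq_div.
rewrite -(big_mkord xpredT (fun i => (i < k %/ d : nat))) (big_cat_nat (leq0n _) le) /=.
rewrite (eq_big_nat _ _ (F2 := fun _ => 1)); last by move=> i /andP[_ ->].
rewrite [X in _ + X]big_nat_cond [X in _ + X]big1 ?addn0.
  by rewrite sum_nat_const_nat subn0 muln1.
by move=> i /andP[/andP[+ _] _]; rewrite leqNgt => /negbTE->.
Qed.

Lemma computable_div n (F G : n.-tuple nat -> nat) :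
  (forall v, 0 < G v) ->
  computable F -> computable G -> computable (fun v => F v %/ G v).
Proof.
move=> G0 CF CG; have := @computable_sum n (fun i v => (i.+1 * G v <= F v : nat)) F.
move=> /(_ _ CF) [].
  apply: computable_leq; last exact: computable_behead.
  by apply: computable_mul; [apply/computable_succ/computable_var0 | apply: computable_behead].
by move=> f Hf; exists f => v; rewrite -divn_sum.
Qed.

Lemma computable_mod n (F G : n.-tuple nat -> nat) :
  (forall v, 0 < G v) ->
  computable F -> computable G -> computable (fun v => F v %% G v).
Proof.
move=> G0 CF CG; have := computable_sub CF (computable_mul (computable_div G0 CF CG) CG).
apply: eq_computable => v; rewrite {1}(divn_eq (F v) (G v)); lia.
Qed.

(** * Codes of lists *)

Lemma codeE n s : CodeSeq.code (n :: s) = 2 ^ n * (2 * CodeSeq.code s).+1.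
Proof. by rewrite /CodeSeq.code /= mul2n. Qed.

Lemma computable_code_cons n (F G : n.-tuple nat -> nat) :
  computable F -> computable G -> computable (fun v => 2 ^ F v * (2 * G v).+1).
Proof.
move=> CF CG; apply: computable_mul; first exact: computable_exp2.
apply/computable_succ/computable_mul => //; exact: computable_const.
Qed.

(** The code is built from the last entry towards the first, so round [i] of the recursion prepends
    the entry with index [C v - 1 - i]. *)
Lemma computable_code_mkseq n (h : nat -> n.-tuple nat -> nat) (C : n.-tuple nat -> nat) :
  computable (fun w : n.+1.-tuple nat => h (thead w) (behead_tuple w)) ->
  computable C -> computable (fun v => CodeSeq.code (mkseq (h^~ v) (C v))).
Proof.
move=> Ch CC.
have Ch' : computable (fun w : n.+2.-tuple nat =>
    h ((C (behead_tuple (behead_tuple w))).-1 - thead w) (behead_tuple (behead_tuple w))).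
  have [||f Hf] := @computable_comp_cons n n.+2 _
    (fun w : n.+2.-tuple nat => (C (behead_tuple (behead_tuple w))).-1 - thead w)
    (fun w => behead_tuple (behead_tuple w)) Ch.
  - apply: computable_sub (computable_var0 _).
    exact: computable_pred (computable_behead (computable_behead CC)).
  - by move=> i; exact: computable_behead (computable_behead (computable_tnth i)).
  by exists f => w; have := Hf w; rewrite thead_cons behead_cons.
have := @computable_rec n (fun _ => 0) C
  (fun i a v => 2 ^ h ((C v).-1 - i) v * (2 * a).+1)
  (computable_const _ _) CC (computable_code_cons Ch' (computable_var1 _)).
apply: eq_computable => v; rewrite /mkseq.
suff main k : k <= C v -> nat_rect (fun _ => nat) 0
    (fun i a => 2 ^ h ((C v).-1 - i) v * (2 * a).+1) k =
    CodeSeq.code [seq h i v | i <- iota (C v - k) k].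
  by rewrite main // subnn.
elim: k => // k IH ltk.
have -> : iota (C v - k.+1) k.+1 = (C v - k.+1) :: iota (C v - k) k.
  by have -> : C v - k = (C v - k.+1).+1 by lia.
rewrite map_cons codeE -(IH (ltnW ltk)).
by have -> : C v - k.+1 = (C v).-1 - k by lia.
Qed.

(* Entry [j] of the [i]-th tuple listed for the A-relation ([input_col]) and for
   the B-relation ([input_row]) of the symbol that depends on [m]. The B-list runs
   over all tuples of labels below 8, the forbidden ones replaced by tuple 0. *)
Definition input_col (m i j : nat) : nat :=
  if j < m then nat_of_bool (i == j)
  else if j == m then nat_of_bool ((0 < i) && (i < m)) else nat_of_bool (i <= m).

Definition digit (i j : nat) : nat := (i %/ 2 ^ (3 * j)) %% 8.

(** Arithmetical form of the negation of [input_ok]: a label [d] has kind [d %/ 2], so [4 <= d]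
    means kind at least 2, and its parity is [hi]. *)
Definition input_bad (m i : nat) : bool :=
  (\sum_(j < m) ((0 < j) && (4 <= digit i j) : nat) == 0) && (digit i m %% 2 == 1)
  || (\sum_(j < m) (digit i j %/ 2 != 1 : nat) == 0) && (digit i m.+1 %% 2 == 0).

Definition input_row (m i j : nat) : nat := digit (if input_bad m i then 0 else i) j.

Definition input_codeA (m : nat) : nat :=
  CodeSeq.code (mkseq (fun i => CodeSeq.code (mkseq (input_col m i) m.+2)) m.+2).

Definition input_codeB (m : nat) : nat :=
  CodeSeq.code (mkseq (fun i => CodeSeq.code (mkseq (input_row m i) m.+2))
                      (2 ^ (3 * m.+2))).

(** The universes have 3 and [m] elements. The code of [x :: s] is [2 ^ x * (2 * code s).+1]; here
    [x] belongs to the input symbol and [s] lists the fixed ones, whose code is [m] itself. *)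
Definition template_code (m : nat) : nat :=
  CodeSeq.code [:: 3; m; 2 ^ CodeSeq.code [:: m.+2; input_codeA m; input_codeB m]
                          * (2 * m).+1].

Lemma computable_digit n (F G : n.-tuple nat -> nat) :
  computable F -> computable G -> computable (fun v => digit (F v) (G v)).
Proof.
move=> CF CG; apply: (computable_mod (G := fun _ => 8)) => //; last exact: computable_const.
apply: (computable_div (G := fun v => 2 ^ (3 * G v))) => //.
  by move=> v; rewrite expn_gt0.
by apply: computable_exp2; apply: computable_mul => //; exact: computable_const.
Qed.

Ltac comp_auto := repeat first
  [ exact: computable_var0 | exact: computable_var1 | exact: computable_var2
  | exact: computable_const
  | assumption | apply: computable_and | apply: computable_or
  | apply: computable_leq | apply: computable_eq | apply: computable_neg
  | apply: computable_succ | apply: computable_mul | apply: computable_digit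
  | apply: computable_exp2 | apply: computable_if ].

Lemma computable_input_bad n (F G : n.-tuple nat -> nat) :
  computable F -> computable G -> computable (fun v => (input_bad (F v) (G v) : nat)).
Proof.
move=> CF CG.
have CFb := computable_behead CF; have CGb := computable_behead CG.
apply: computable_or; apply: computable_and.
- apply: computable_eq; last exact: computable_const.
  apply: (computable_sum (h := fun j v => ((0 < j) && (4 <= digit (G v) j) : nat))) => //.
  by comp_auto.
- apply: computable_eq; last exact: computable_const.
  by apply: (computable_mod (G := fun _ => 2)) => //; comp_auto.
- apply: computable_eq; last exact: computable_const.
  apply: (computable_sum (h := fun j v => (digit (G v) j %/ 2 != 1 : nat))) => //.
  apply: computable_neg; apply: computable_eq; last exact: computable_const.
  by apply: (computable_div (G := fun _ => 2)) => //; comp_auto.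
- apply: computable_eq; last exact: computable_const.
  apply: (computable_mod (G := fun _ => 2)) => //; last exact: computable_const.
  by apply: computable_digit => //; apply: computable_succ.
Qed.

Lemma computable_template_code :
  computable (fun v : 1.-tuple nat => template_code (thead v)).
Proof.
have C0 := computable_var0 0.
have CA : computable (fun v : 1.-tuple nat => input_codeA (thead v)).
  apply: (computable_code_mkseq (h := fun i v =>
    CodeSeq.code (mkseq (input_col (thead v) i) (thead v).+2))); last by comp_auto.
  apply: (computable_code_mkseq (h := fun j (v : 2.-tuple nat) =>
    input_col (thead (behead_tuple v)) (thead v) j)); last by comp_auto.
  rewrite /input_col.
  apply: computable_if; [by comp_auto | by comp_auto |].
  by apply: computable_if; comp_auto.
have CB : computable (fun v : 1.-tuple nat => input_codeB (thead v)).
  apply: (computable_code_mkseq (h := fun i v =>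
    CodeSeq.code (mkseq (input_row (thead v) i) (thead v).+2))); last first.
    by apply: computable_exp2; apply: computable_mul; comp_auto.
  apply: (computable_code_mkseq (h := fun j (v : 2.-tuple nat) =>
    input_row (thead (behead_tuple v)) (thead v) j)); last by comp_auto.
  rewrite /input_row; apply: computable_digit; last exact: computable_var0.
  apply: computable_if; last exact: computable_var1.
  - by apply: computable_input_bad; [exact: computable_var2 | exact: computable_var1].
  - exact: computable_const.
have C := computable_code_cons (computable_const 1 3) (computable_code_cons C0
  (computable_code_cons (computable_code_cons
   (computable_code_cons (computable_succ (computable_succ C0))
     (computable_code_cons CA (computable_code_cons CB (computable_const 1 0)))) C0)
   (computable_const 1 0))).
by apply: eq_computable C => v; rewrite /template_code !codeE.
Qed.

(** * Templates given by columns and label predicates *)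

Definition word n (u : nat -> nat) : n.-tuple 'I_3 := [tuple inord (u j) | j < n].

Lemma eq_word n u v : (forall j, j < n -> u j = v j) -> word n u = word n v.
Proof. by move=> E; apply: eq_from_tnth => j; rewrite !tnth_mktuple E. Qed.

(* A relation symbol of arity [rar.+1]; the B-relation is given both by a
   predicate and by the list that enters the code of the template. *)
Record rdesc (Lb : finType) := RDesc {
  rar : nat;
  rcols : seq (seq nat);
  rP : seq Lb -> bool;
  rB : seq (rar.+1.-tuple Lb);
  rBP : forall t, (t \in rB) = rP t
}.

Section Template.
Variable Lb : finType.

Definition rA (d : rdesc Lb) : seq ((rar d).+1.-tuple 'I_3) :=
  [seq word (rar d).+1 (nth 0 c) | c <- rcols d].

Lemma mk_desc_proof k (P : seq Lb -> bool) (t : k.+1.-tuple Lb) :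
  (t \in enum [pred t : k.+1.-tuple Lb | P t]) = P t.
Proof. by rewrite mem_enum. Qed.

Definition mk_desc k cols (P : seq Lb -> bool) : rdesc Lb :=
  @RDesc Lb k cols P _ (@mk_desc_proof k P).

Variables (ds : seq (rdesc Lb)) (e : nat).

Definition dnth (R : 'I_(size ds)) : rdesc Lb := tnth (in_tuple ds) R.

Definition dsig : signature :=
  @Signature 'I_(size ds) (fun R => (rar (dnth R)).+1) (fun R => ltn0Sn _).

Definition dA : structure dsig :=
  @Structure dsig 'I_3 (fun R => [set t in rA (dnth R)]).

Definition dBt (d : rdesc Lb) : seq ((rar d).+1.-tuple (Lb + 'I_e)%type) :=
  [seq map_tuple inl t | t <- rB d].

(** The [e] additional elements lie in no relation; they adjust the size of the universe, which
    enters the code. *)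
Definition dB : structure dsig :=
  @Structure dsig (Lb + 'I_e)%type (fun R => [set t in dBt (dnth R)]).

(** The polymorphism condition read by rows: coordinate [j] chooses a column [q j] of the
    A-relation, and the [i]-th entries of the chosen columns form the [i]-th word. *)
Definition sat n (phi : n.-tuple 'I_3 -> Lb) (d : rdesc Lb) : Prop :=
  forall q : nat -> seq nat, (forall j, j < n -> q j \in rcols d) ->
    rP d (mkseq (fun i => phi (word n (fun j => nth 0 (q j) i))) (rar d).+1).

Lemma mem_dBt (d : rdesc Lb) (t : (rar d).+1.-tuple Lb) :
  map_tuple inl t \in dBt d = rP d t.
Proof.
rewrite mem_map ?rBP // => x y /(congr1 val) /= E.
by apply: val_inj; apply: inj_map E => a b [].
Qed.

Lemma sat_hom n (phi : n.-tuple 'I_3 -> Lb) :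
  (forall R, sat phi (dnth R)) ->
  homomorphism (A := power dA n) (B := dB) (fun w => inl (phi w)).
Proof.
move=> S R t; rewrite !inE => /forallP Ht; move: (S R) => {S} Sd.
have [q Hq] : exists q : nat -> seq nat, forall j : 'I_n,
    q j \in rcols (dnth R) /\
    map_tuple (fun a : n.-tuple 'I_3 => tnth a j) t = word _ (nth 0 (q j)).
  have [q Hq] : exists q : 'I_n -> seq nat, forall j, q j \in rcols (dnth R) /\
      map_tuple (fun a : n.-tuple 'I_3 => tnth a j) t = word _ (nth 0 (q j)).
    apply: (@fin_all_exists _ (fun=> seq nat) (fun j c => c \in rcols (dnth R) /\
      map_tuple (fun a : n.-tuple 'I_3 => tnth a j) t = word _ (nth 0 c))) => j.
    by have := Ht j; rewrite inE => /mapP[c cd E]; exists c.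
  case: n phi t {Ht Sd} q Hq => [|n] phi t q Hq; first by exists (fun _ => [::]) => -[].
  by exists (fun j => q (inord j)) => j; rewrite inord_val.
have tE i : tnth t i = word n (fun j => nth 0 (q j) i).
  apply: eq_from_tnth => j; have [_ E] := Hq j.
  have := congr1 (fun x => tnth x i) E.
  by rewrite tnth_map !tnth_mktuple.
have -> : map_tuple (fun w => inl (phi w)) t =
    map_tuple inl (map_tuple phi t) :> (rar (dnth R)).+1.-tuple (Lb + 'I_e).
  by apply: val_inj; rewrite /= -map_comp.
rewrite (mem_dBt (map_tuple phi t)).
have := Sd q (fun j lj => (Hq (Ordinal lj)).1); congr (rP _ _).
apply: (@eq_from_nth _ (phi (word n (fun=> 0)))); rewrite ?size_mkseq ?size_tuple // => i li.
rewrite nth_mkseq // (nth_map (word n (fun=> 0))) ?size_tuple //.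
by have := tE (Ordinal li); rewrite (tnth_nth (word n (fun=> 0))) => ->.
Qed.

Definition unlab (l0 : Lb) (b : Lb + 'I_e) : Lb := if b is inl l then l else l0.

(** The B-relations contain only [inl] values, so on the words that matter [unlab] loses nothing,
    whatever the default [l0]. *)
Lemma hom_sat n l0 (f : power dA n -> dB) :
  homomorphism f -> forall R, sat (fun w => unlab l0 (f w)) (dnth R).
Proof.
move=> Hf R q Hq.
pose t : (rar (dnth R)).+1.-tuple (n.-tuple 'I_3) :=
  [tuple word n (fun j => nth 0 (q j) i) | i < (rar (dnth R)).+1].
have /(Hf R) : t \in rel_of (power dA n) R.
  rewrite inE; apply/forallP => j; rewrite inE; apply/mapP.
  exists (q j); first exact: Hq.
  by apply: eq_from_tnth => i; rewrite tnth_map !tnth_mktuple.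
rewrite inE => /mapP[s]; rewrite rBP => Ps E; move: Ps; congr (rP _ _).
apply: (@eq_from_nth _ l0); rewrite ?size_mkseq ?size_tuple // => i li.
rewrite nth_mkseq // -(tnth_nth l0 s (Ordinal li)).
have := congr1 (fun x => tnth x (Ordinal li)) E.
by rewrite !tnth_map tnth_ord_tuple => ->.
Qed.

Lemma const_hom (phi : 'I_3 -> Lb) :
  (forall R, all (fun c => rP (dnth R) (mkseq (fun i => phi (inord (nth 0 c i)))
                                         (rar (dnth R)).+1)) (rcols (dnth R))) ->
  homomorphism (A := dA) (B := dB) (fun a => inl (phi a)).
Proof.
move=> S R t; rewrite !inE => /mapP[c cd ->].
have -> : map_tuple (fun a => inl (phi a)) (word (rar (dnth R)).+1 (nth 0 c)) =
    map_tuple inl (map_tuple phi (word (rar (dnth R)).+1 (nth 0 c)))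
    :> (rar (dnth R)).+1.-tuple (Lb + 'I_e).
  by apply: eq_from_tnth => i; rewrite !tnth_map.
rewrite mem_dBt; have := allP (S R) c cd; congr (rP _ _).
apply: (@eq_from_nth _ (phi ord0)); rewrite ?size_mkseq ?size_tuple // => i li.
rewrite -(tnth_nth _ (map_tuple phi _) (Ordinal li)) tnth_map tnth_mktuple.
by rewrite nth_mkseq.
Qed.

Variable labs : seq Lb.
Hypothesis labs_enum : enumerates labs.

Definition desc_code (d : rdesc Lb) : nat :=
  CodeSeq.code [:: (rar d).+1; code_tuples (enum 'I_3) (rA d); code_tuples labs (rB d)].

(** Labels are listed before the padding, so that their indices in [sB] agree with those in
    [labs]. *)
Lemma encodes_desc (h : exists h : dA -> dB, homomorphism h) :
  encodes (Template h)
    (CodeSeq.code [:: 3; #|Lb| + e; CodeSeq.code [seq desc_code d | d <- ds]]).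
Proof.
pose sB : seq (Lb + 'I_e) := [seq inl l | l <- labs] ++ [seq inr i | i <- enum 'I_e].
have [labs_uniq labs_mem] := labs_enum.
exists (enum 'I_(size ds)), (enum 'I_3), sB,
  (fun R => rA (dnth R)), (fun R => dBt (dnth R)).
have inl_inj : injective (@inl Lb 'I_e) by move=> x y [].
have inr_inj : injective (@inr Lb 'I_e) by move=> x y [].
split.
- by split; [exact: enum_uniq | move=> x; rewrite mem_enum].
- by split; [exact: enum_uniq | move=> x; rewrite mem_enum].
- split.
    rewrite cat_uniq; apply/and3P; split.
    - by rewrite (map_inj_uniq inl_inj).
    - by apply/hasPn => _ /mapP[i _ ->]; apply/negP => /mapP[].
    - by rewrite (map_inj_uniq inr_inj) enum_uniq.
  move=> [l|i]; rewrite mem_cat inE.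
    by rewrite mem_map // labs_mem.
  by rewrite [X in _ || X]mem_map // mem_enum orbT.
- by move=> R; split=> t; rewrite inE.
have labs_size : size labs = #|Lb|.
  by rewrite cardT; apply/perm_size/uniq_perm; rewrite ?enum_uniq // => x;
     rewrite mem_enum labs_mem.
congr CodeSeq.code; congr [:: _; _; _].
- by symmetry; exact: size_enum_ord.
- by symmetry; rewrite size_cat 2!size_map labs_size size_enum_ord.
congr CodeSeq.code.
rewrite -[X in map _ X](map_tnth_enum (in_tuple ds)) -map_comp.
apply: eq_map => R; rewrite -[LHS]/(desc_code (dnth R)) /desc_code.
congr CodeSeq.code; congr [:: _; _; _]; rewrite /code_tuples /dBt -map_comp; congr CodeSeq.code.
apply: eq_map => t; congr CodeSeq.code.
rewrite -[RHS]/(map _ (map inl t)) -map_comp; apply: eq_map => l.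
by rewrite /= /sB index_cat mem_map // labs_mem index_map.
Qed.
End Template.

(** * The labels and the relations *)

(* [inl d] labels the words over {0,1}: [d %/ 2] is 0 for the empty set, 1 for a
   singleton, 2 or 3 otherwise, and [odd d] says that the set has at least [m]
   elements, where [m] is the input of the machine. [inr (q, b, lt, dv)] labels
   the words with [a] ones and [c > 0] twos: after [c] steps the machine is in
   state [q], [b i] is [a < r_i], [lt] is [c < a], and [dv] says that [a] divides
   the number of zeros. *)
Definition label (M : machine) : finType :=
  ('I_8 + (mQ M * {ffun mI M -> bool} * bool * bool))%type.

Section Labels.
Variable M : machine.
Implicit Types l : label M.

Definition kind l : nat := if l is inl d then d %/ 2 else 4.
Definition is_bin l : bool := if l is inl _ then true else false.
Definition hi l : bool := if l is inl d then odd d else false.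
Definition vq l : mQ M := if l is inr (q, _, _, _) then q else mstart M.
(** Binary words describe time 0, when only the input register can be nonzero; it holds [m], which
    exceeds the number of ones when [d] is even. *)
Definition vb l (i : mI M) : bool :=
  match l with inl d => (i == minp M) && ~~ odd d | inr (_, b, _, _) => b i end.
Definition vlt l : bool := if l is inr (_, _, lt, _) then lt else false.
(** In prime arity [n], a number [a > 0] of ones divides [n - a] exactly for [a = 1] and [a = n],
    that is, when the kind is not 2. *)
Definition vdv l : bool := match l with inl d => d %/ 2 != 2 | inr (_, _, _, dv) => dv end.

Definition lab0 : label M := inl ord0.

Definition next_q (q : mQ M) (b : mI M -> bool) : mQ M :=
  let: (i, _, z, nz) := mprog q in if b i then nz else z.

(** [bm], [b], [bp] are the truth values of [a - 1 < r_j], [a < r_j], [a + 1 < r_j] before the step,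
    the first being true for [a = 0]; the action selects which of them becomes [a < r_j]. *)
Definition next_b (q : mQ M) (j : mI M) (bm b bp : bool) : bool :=
  let: (i, a, _, _) := mprog q in
  if j == i then match a with Up => bm | Down => bp | Keep => b end else b.

(** The labels are those of two disjoint sets and their union; kind 3 means large. Kind 2 is closed
    under unions only for WNUs: in the intended cyclic labelling the full set can be a union of two
    sets of kind 2. *)
Definition plus_ok (cyc : bool) (l1 l2 l3 : label M) : bool :=
  [&& ~~ ((kind l1 == 3) && (kind l2 == 3)),
      (kind l1 == 0) && (kind l2 == 0) ==> (kind l3 == 0)
    & [&& ~~ cyc, kind l1 == 2 & kind l2 == 2] ==> (kind l3 == 2)].

(** [l0] labels a word over {0,2}, [l1] and [l2] the words with a set of its zeros turned to ones
    and to twos, and [e] that set. The premise restricts the rule to a single changed position. *)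
Definition window0_ok (l0 l1 l2 e : label M) : bool :=
  (kind e == 1) ==>
  (vq l2 == next_q (vq l0) (vb l0)) &&
  [forall j, vb l2 j == next_b (vq l0) j true (vb l0 j) (vb l1 j)].

(** With [e] and [e'] singletons, [lm], [l], [lp] label words with [a - 1], [a], [a + 1] ones and
    equal twos, [l0] the word with these twos and no ones, and [l'] the word of [l] with one more
    two. *)
Definition window_ok (l0 lm l lp l' e e' : label M) : bool :=
  (kind e == 1) && (kind e' == 1) ==>
  [forall j, vb l' j == next_b (vq l0) j (vb lm j) (vb l j) (vb lp j)].

(** By the columns, row [m] is the union of rows 1 to [m - 1], so it has fewer than [m] elements if
    these are at most singletons; row [m + 1] contains the disjoint rows 0 to [m - 1], so it has at
    least [m] if these are singletons. *)
Definition input_ok (m : nat) (s : seq (label M)) : bool :=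
  [&& all is_bin s,
      [forall j : 'I_m, (0 < j) ==> (kind (nth lab0 s j) < 2)] ==> ~~ hi (nth lab0 s m)
    & [forall j : 'I_m, kind (nth lab0 s j) == 1] ==> hi (nth lab0 s m.+1)].

Local Notation "s `# i" := (nth lab0 s i) (at level 2, format "s `# i").

(** The symbol depending on [c2] reads the state on words without ones: it must be [mZ] after [n]
    steps, or differ from [mN] at all times up to [n]. The last symbol has empty relations and a
    large arity, which makes the code of the list exceed the number of labels. *)
Definition common_descs (cyc c2 : bool) : seq (rdesc (label M)) :=
  [:: mk_desc 0 [:: [:: 0]; [:: 1]] (fun s => is_bin s`#0);
      mk_desc 0 [:: [:: 0]] (fun s => kind s`#0 == 0);
      mk_desc 0 [:: [:: 1]] (fun s => kind s`#0 == 3);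
      mk_desc 2 [:: [:: 0; 0; 0]; [:: 1; 0; 1]; [:: 0; 1; 1]]
        (fun s => plus_ok cyc s`#0 s`#1 s`#2);
      mk_desc 3 [:: [:: 0; 0; 0; 0]; [:: 2; 2; 2; 0]; [:: 0; 1; 2; 1]]
        (fun s => window0_ok s`#0 s`#1 s`#2 s`#3);
      mk_desc 6 [:: [:: 0; 0; 0; 0; 0; 0; 0]; [:: 0; 1; 1; 1; 1; 0; 0];
                    [:: 2; 2; 2; 2; 2; 0; 0]; [:: 0; 0; 1; 1; 1; 1; 0];
                    [:: 0; 0; 0; 1; 2; 0; 1]]
        (fun s => window_ok s`#0 s`#1 s`#2 s`#3 s`#4 s`#5 s`#6);
      if c2 then mk_desc 0 [:: [:: 2]] (fun s => vq s`#0 == mZ M)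
      else mk_desc 0 [:: [:: 0]; [:: 2]] (fun s => vq s`#0 != mN M);
      mk_desc #|label M| [::] (fun _ => false)].

(** The first two symbols make [vlt] asymmetric and transitive as a comparison of the set of twos
    with the set of ones. The third turns twos to zeros, if these positions and the ones are
    incomparable, and preserves [vdv]; the fourth starts it at words without zeros. *)
Definition cyclic_descs : seq (rdesc (label M)) :=
  [:: mk_desc 1 [:: [:: 0; 0]; [:: 2; 1]; [:: 1; 2]]
        (fun s => ~~ (vlt s`#0 && vlt s`#1));
      mk_desc 2 [:: [:: 0; 0; 0]; [:: 2; 0; 2]; [:: 1; 2; 0]; [:: 0; 1; 1]]
        (fun s => vlt s`#0 && vlt s`#1 ==> vlt s`#2);
      mk_desc 3 [:: [:: 0; 0; 0; 0]; [:: 2; 2; 0; 0]; [:: 1; 1; 1; 2]; [:: 0; 2; 2; 1]]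
        (fun s => [&& ~~ vlt s`#2, ~~ vlt s`#3 & vdv s`#1] ==> vdv s`#0);
      mk_desc 0 [:: [:: 1]; [:: 2]] (fun s => vdv s`#0)].

Definition fixed_descs (cyc c2 : bool) :=
  common_descs cyc c2 ++ (if cyc then cyclic_descs else [::]).

Definition input_cols (m : nat) : seq (seq nat) :=
  mkseq (fun i => mkseq (input_col m i) m.+2) m.+2.

Definition input_list (m : nat) : seq (m.+2.-tuple (label M)) :=
  mkseq (fun i => [tuple inl (inord (input_row m i j)) | j < m.+2]) (2 ^ (3 * m.+2)).

Lemma digit_lt i j : digit i j < 8.
Proof. exact: ltn_pmod. Qed.

Lemma digits_exist k (d : nat -> nat) : (forall j, j < k -> d j < 8) ->
  exists2 i, i < 2 ^ (3 * k) & forall j, j < k -> digit i j = d j.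
Proof.
elim: k => [|k IH] Hd; first by exists 0; rewrite ?muln0.
have [|i lt_i Hi] := IH; first by move=> j lj; apply: Hd; apply: ltnW.
exists (d k * 2 ^ (3 * k) + i).
  have -> : 2 ^ (3 * k.+1) = 8 * 2 ^ (3 * k) by rewrite mulnS expnD.
  have := Hd k (ltnSn k); nia.
move=> j; rewrite ltnS leq_eqVlt => /orP[/eqP->|lj].
  rewrite /digit divnMDl ?expn_gt0 // divn_small // addn0 modn_small //.
  exact: Hd.
rewrite -(Hi j lj) /digit.
have -> : 2 ^ (3 * k) = 2 ^ (3 * (k - j.+1)) * 8 * 2 ^ (3 * j).
  by rewrite -[8]/(2 ^ 3) -!expnD; congr expn; lia.
by rewrite !mulnA divnMDl ?expn_gt0 // modnMDl.
Qed.

Lemma sum_bool_eq0 m (p : nat -> bool) :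
  (\sum_(j < m) (p j : nat) == 0) = [forall j : 'I_m, ~~ p j].
Proof.
rewrite sum_nat_eq0; apply/forallP/forallP => H j; have := H j; first by case: (p j).
by case: (p j).
Qed.

Lemma input_bad_ok m i (s : seq (label M)) : size s = m.+2 ->
  (forall j, j < m.+2 -> s`#j = inl (inord (digit i j))) ->
  input_ok m s = ~~ input_bad m i.
Proof.
move=> ss Hs; rewrite /input_ok /input_bad negb_or.
have val_d j : nat_of_ord (inord (digit i j) : 'I_8) = digit i j.
  by rewrite inordK ?digit_lt.
have hiE j : j < m.+2 -> hi s`#j = (digit i j %% 2 == 1).
  by move=> lj; rewrite Hs //= val_d modn2 eqb1.
have kindE j : j < m.+2 -> kind s`#j = digit i j %/ 2.
  by move=> lj; rewrite Hs //= val_d.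
have -> : all is_bin s.
  by apply/(all_nthP lab0) => j; rewrite ss => lj; rewrite Hs.
rewrite /= !negb_and hiE // hiE // !implybE.
rewrite (sum_bool_eq0 m (fun j => (0 < j) && (4 <= digit i j))).
rewrite (sum_bool_eq0 m (fun j => digit i j %/ 2 != 1)); congr (_ && _).
  congr (~~ _ || _); apply: eq_forallb => j; rewrite kindE; last by have := ltn_ord j; lia.
  by case: (0 < j) => //=; rewrite -ltnNge ltn_divLR.
congr (~~ _ || _).
  apply: eq_forallb => j; rewrite kindE ?negbK //; have := ltn_ord j; lia.
by rewrite modn2; case: odd.
Qed.

Lemma input_list_ok m (t : m.+2.-tuple (label M)) :
  0 < m -> (t \in input_list m) = input_ok m t.
Proof.
move=> m0.
(* Tuple 0 is allowed and can replace the forbidden ones: all its labels have kind 0 and [hi] false,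
   and [0 < m] makes the last clause vacuous. *)
have bad0 : input_bad m 0 = false.
  rewrite /input_bad /digit !div0n !mod0n /= andbF /=.
  apply/negbTE; rewrite andbT (sum_bool_eq0 m (fun j => (0 %/ 2 ^ (3 * j)) %% 8 %/ 2 != 1)).
  by apply/forallPn; exists (Ordinal m0); rewrite div0n mod0n.
apply/mapP/idP => [[i _ ->]|Hok].
  rewrite (@input_bad_ok m (if input_bad m i then 0 else i)) ?size_tuple //.
    by case: ifP => [_|->]; rewrite ?bad0.
  by move=> j lj; rewrite -(tnth_nth _ _ (Ordinal lj)) tnth_mktuple.
have /and3P[/allP Hbin _ _] := Hok.
pose d j := if t`#j is inl x then nat_of_ord x else 0.
have Hd j : j < m.+2 -> d j < 8 by rewrite /d; case: (t`#j).
have tE j : j < m.+2 -> t`#j = inl (inord (d j)).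
  move=> lj; have := Hbin t`#j; rewrite mem_nth ?size_tuple // => /(_ isT).
  by rewrite /d; case: (t`#j) => // x _; rewrite inord_val.
have [i lt_i Hi] := digits_exist Hd.
exists i; first by rewrite mem_iota.
have Hnb : input_bad m i = false.
  apply/negbTE; rewrite -(@input_bad_ok m i t) ?size_tuple //.
  by move=> j lj; rewrite tE // Hi.
apply: eq_from_tnth => j; rewrite tnth_mktuple (tnth_nth lab0) tE //.
by rewrite /input_row Hnb Hi.
Qed.

Definition input_desc m (m0 : 0 < m) : rdesc (label M) :=
  @RDesc _ m.+1 (input_cols m) (input_ok m) (input_list m)
    (fun t => @input_list_ok m t m0).

(** With the binary labels first, [inl d] has index [d]; hence the code of the input symbol does not
    depend on the machine. *)
Definition labels : seq (label M) :=
  [seq inl d | d <- enum 'I_8] ++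
  [seq inr x | x <- enum {: mQ M * {ffun mI M -> bool} * bool * bool}].

Lemma labels_enum : enumerates labels.
Proof.
have inl_inj : injective (@inl 'I_8 (mQ M * {ffun mI M -> bool} * bool * bool)).
  by move=> x y [].
have inr_inj : injective (@inr 'I_8 (mQ M * {ffun mI M -> bool} * bool * bool)).
  by move=> x y [].
split.
  rewrite cat_uniq; apply/and3P; split.
  - by rewrite (map_inj_uniq inl_inj) enum_uniq.
  - by apply/hasPn => _ /mapP[i _ ->]; apply/negP => /mapP[].
  - by rewrite (map_inj_uniq inr_inj) enum_uniq.
move=> [l|i]; rewrite mem_cat inE.
  by rewrite mem_map // mem_enum.
by rewrite [X in _ || X]mem_map // mem_enum orbT.
Qed.

Lemma input_desc_code m (m0 : 0 < m) :
  desc_code labels (input_desc m0) =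
  CodeSeq.code [:: m.+2; input_codeA m; input_codeB m].
Proof.
rewrite /desc_code; congr CodeSeq.code; congr [:: _; _; _].
  rewrite /code_tuples /input_codeA; congr CodeSeq.code.
  rewrite /rA /input_cols /mkseq -!map_comp; apply: eq_map => i.
  congr CodeSeq.code; rewrite -[LHS]/(map _ (map _ _)) -map_comp.
  rewrite -[iota 0 m.+2]val_enum_ord -[RHS]map_comp.
  rewrite -[val (ord_tuple _)]/(enum 'I_m.+2).
  apply: eq_map => j.
  rewrite -[LHS]/(index (inord (nth 0 (mkseq (input_col m i) m.+2) j)) (enum 'I_3)).
  rewrite nth_mkseq // index_enum_ord inordK //.
  by rewrite /input_col /=; do 2?case: ifP => _; case: (X in nat_of_bool X).
rewrite /code_tuples /input_codeB; congr CodeSeq.code.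
rewrite -[rB _]/(input_list m) /input_list /mkseq -!map_comp; apply: eq_map => i.
congr CodeSeq.code; rewrite -[LHS]/(map _ (map _ _)) -map_comp.
rewrite -[iota 0 m.+2]val_enum_ord -[RHS]map_comp.
rewrite -[val (ord_tuple _)]/(enum 'I_m.+2).
apply: eq_map => j.
rewrite -[LHS]/(index (inl (inord (input_row m i j))) labels).
rewrite /labels index_cat mem_map ?mem_enum; last by move=> x y [].
by rewrite index_map ?index_enum_ord ?inordK ?digit_lt //; move=> x y [].
Qed.
End Labels.

(** * Labels forced on a polymorphism *)

Fixpoint allp T (P : T -> Prop) (s : seq T) : Prop :=
  if s is x :: s' then P x /\ allp P s' else True.

Lemma allp_nth T (P : T -> Prop) s :
  allp P s <-> forall i : 'I_(size s), P (tnth (in_tuple s) i).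
Proof.
split=> [|H].
  elim: s => [|x s IH] /=; first by move=> _ [].
  move=> [Px /IH Ps] i; case: (unliftP ord0 i) => [j ->|->].
    by have := Ps j; rewrite !(tnth_nth x).
  by rewrite (tnth_nth x).
elim: s H => [|x s IH] //= H; split; first by have := H ord0; rewrite (tnth_nth x).
by apply: IH => i; have := H (lift ord0 i); rewrite !(tnth_nth x).
Qed.

Lemma allp_cat T (P : T -> Prop) s1 s2 :
  allp P (s1 ++ s2) <-> allp P s1 /\ allp P s2.
Proof. by elim: s1 => [|x s IH] /=; tauto. Qed.

(** * Counting the letters of a word *)

Definition num n (x : nat) (u : nat -> nat) : nat := count (fun j => u j == x) (iota 0 n).

Lemma eq_num n x y u v : (forall j, j < n -> (u j == x) = (v j == y)) ->
  num n x u = num n y v.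
Proof. by move=> E; apply: eq_in_count => j; rewrite mem_iota => /andP[_ /E]. Qed.

Lemma num_sum n x u : num n x u = \sum_(j < n) (u j == x : nat).
Proof.
have -> : num n x u = count (fun j => u j == x) (index_iota 0 n).
  by rewrite /index_iota subn0.
rewrite -sum1_count big_mkcond big_mkord.
by apply: eq_bigr => j _; case: eqP.
Qed.

Lemma num_upd n x u y v : y < n ->
  num n x (upd u y v) + (u y == x) = num n x u + (v == x).
Proof.
move=> ly; rewrite !num_sum (bigD1 (Ordinal ly)) //= [in RHS](bigD1 (Ordinal ly)) //=.
rewrite upd_same (eq_bigr (fun j : 'I_n => (u j == x : nat))); first by lia.
by move=> j; rewrite -val_eqE /= => /eqP jy; rewrite upd_other.
Qed.

Lemma num_gt0 n x u : 0 < num n x u -> exists2 y, y < n & u y = x.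
Proof.
by rewrite -has_count => /hasP[y]; rewrite mem_iota => /andP[_ ly] /eqP; exists y.
Qed.

Lemma num_eq0 n x u : num n x u = 0 -> forall j, j < n -> u j <> x.
Proof.
move=> /eqP; rewrite -leqn0 leqNgt -has_count => /hasPn H j lj.
by have := H j; rewrite mem_iota lj => /(_ isT) /eqP.
Qed.

Definition sing (i : nat) : nat -> nat := fun j => nat_of_bool (j == i).

(** * Local rules obeyed by the run of the machine *)

Section Run.
Variables (M : machine) (m : nat).

Local Notation rq c := (run M m c).1.
Local Notation rr c := (run M m c).2.

Lemma eq_next_q (q : mQ M) b b' : b =1 b' -> next_q q b = next_q q b'.
Proof. by move=> E; rewrite /next_q; case: mprog => [[[i a] z] nz]; rewrite E. Qed.

Lemma run_next_q c : rq c.+1 = next_q (rq c) (fun i => 0 < rr c i).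
Proof.
rewrite /run iterS -/(run M m c) /mstep /next_q.
by case: mprog => [[[i a] z] nz] /=; case: (rr c i).
Qed.

Lemma run_next_b c a j :
  (a < rr c.+1 j) =
  next_b (rq c) j (if a == 0 then true else a.-1 < rr c j) (a < rr c j) (a.+1 < rr c j).
Proof.
rewrite /run iterS -/(run M m c) /mstep /next_b.
case: mprog => [[[i b] z] nz] /=; case: eqP => // ->.
by case: b => //=; [case: a | case: (rr c i)].
Qed.

Lemma run_absorb q t c : absorbing q -> rq t = q -> t <= c -> rq c = q.
Proof.
move=> abs Et /subnK <-; elim: (c - t) => // d IH.
rewrite addSn /run iterS -/(run M m (d + t)).
by have := abs (rr (d + t)); rewrite -{1}IH -surjective_pairing.
Qed.
End Run.

Section Forcing.
Variables (M : machine) (cyc c2 : bool) (n : nat).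
Variable phi : n.-tuple 'I_3 -> label M.
Hypothesis Hcom : allp (sat phi) (common_descs M cyc c2).

Local Notation f u := (phi (word n u)).

Lemma forced_bin u : (forall j, j < n -> u j < 2) -> is_bin (f u).
Proof.
move=> Hu; case: Hcom => s _; apply: (s (fun j => [:: u j])) => j /Hu /=.
by rewrite !inE !eqseq_cons !andbT; lia.
Qed.

Lemma forced_zero : kind (f (fun=> 0)) = 0.
Proof. by case: Hcom => _ [s _]; apply/eqP; apply: (s (fun=> [:: 0])). Qed.

Lemma forced_one : kind (f (fun=> 1)) = 3.
Proof. by case: Hcom => _ [_ [s _]]; apply/eqP; apply: (s (fun=> [:: 1])). Qed.

Lemma forced_plus u v : (forall j, j < n -> u j + v j < 2) ->
  plus_ok cyc (f u) (f v) (f (fun j => u j + v j)).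
Proof.
move=> Hu; case: Hcom => _ [_ [_ [s _]]].
apply: (s (fun j => [:: u j; v j; u j + v j])) => j /Hu /=.
by rewrite !inE !eqseq_cons !andbT; lia.
Qed.

Lemma forced_window0 q :
  (forall j, j < n -> q j \in [:: [:: 0; 0; 0; 0]; [:: 2; 2; 2; 0]; [:: 0; 1; 2; 1]]) ->
  window0_ok (f (fun j => nth 0 (q j) 0)) (f (fun j => nth 0 (q j) 1))
             (f (fun j => nth 0 (q j) 2)) (f (fun j => nth 0 (q j) 3)).
Proof. by case: Hcom => _ [_ [_ [_ [s _]]]] Hq; exact: (s q). Qed.

Lemma forced_window q :
  (forall j, j < n -> q j \in [:: [:: 0; 0; 0; 0; 0; 0; 0]; [:: 0; 1; 1; 1; 1; 0; 0];
                    [:: 2; 2; 2; 2; 2; 0; 0]; [:: 0; 0; 1; 1; 1; 1; 0];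
                    [:: 0; 0; 0; 1; 2; 0; 1]]) ->
  window_ok (f (fun j => nth 0 (q j) 0)) (f (fun j => nth 0 (q j) 1))
    (f (fun j => nth 0 (q j) 2)) (f (fun j => nth 0 (q j) 3))
    (f (fun j => nth 0 (q j) 4)) (f (fun j => nth 0 (q j) 5)) (f (fun j => nth 0 (q j) 6)).
Proof. by case: Hcom => _ [_ [_ [_ [_ [s _]]]]] Hq; exact: (s q). Qed.

Lemma forced_kind_lt u : (forall j, j < n -> u j < 2) -> kind (f u) < 4.
Proof.
by move/forced_bin; rewrite /kind; case: (f u) => // d _; rewrite ltn_divLR.
Qed.

(** Two disjoint singletons cannot both have kind 3. Kind 0, or kind 2 where unions preserve it,
    would spread to all initial segments by adding one position at a time, but the full set has kind
    3. *)
Lemma singles_kind k : 1 < n -> (forall i, i < n -> kind (f (sing i)) = k) ->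
  (k = 2 -> ~~ cyc) -> k = 1.
Proof.
move=> n1 Hk k2.
have k4 : k < 4 by rewrite -(Hk 0) ?forced_kind_lt 1?ltnW // => j _; rewrite /sing; case: eqP.
have k3 : k <> 3.
  move=> k3.
  have /and3P[+ _ _] : plus_ok cyc (f (sing 0)) (f (sing 1))
      (f (fun j => sing 0 j + sing 1 j)).
    by apply: forced_plus => j _; rewrite /sing; lia.
  by rewrite (Hk 0 (ltnW n1)) (Hk 1 n1) k3.
have k02 : ~ (k = 0 \/ k = 2 /\ ~~ cyc).
  move=> Hk'.
  have pre a : 0 < a <= n -> kind (f (fun j => nat_of_bool (j < a))) = k.
    elim: a => // -[_ /= n0|a IH /= an].
      by rewrite -(Hk 0) //; congr kind; congr phi; apply: eq_word => j _; rewrite /sing; lia.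
    have := @forced_plus (fun j => nat_of_bool (j < a.+1)) (sing a.+1).
    rewrite /plus_ok IH ?(ltnW an) // Hk //.
    have -> : f (fun j => (j < a.+1) + sing a.+1 j) = f (fun j => nat_of_bool (j < a.+2)).
      by congr phi; apply: eq_word => j _; rewrite /sing; lia.
    case/(_ _)/and3P; first by move=> j _; rewrite /sing; lia.
    by case: Hk' => [->|[-> ->]] //= _ => [/eqP|_ /eqP].
  have := pre n; rewrite (ltnW n1) leqnn => /(_ isT).
  have -> : f (fun j => nat_of_bool (j < n)) = f (fun=> 1).
    by congr phi; apply: eq_word => j ->.
  by rewrite forced_one; case: Hk' => [->|[-> _]].
case: k k4 k3 k02 k2 {Hk} => [|[|[|[|]]]] // _ _ H H2.
  by case: H; left.
by case: H; right; split=> //; apply: H2.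
Qed.

Variables (m : nat) (m0 : 0 < m).
Hypothesis Hin : sat phi (input_desc M m0).
Hypothesis Hsing : forall i, i < n -> kind (f (sing i)) = 1.

Lemma forced_input u : (forall j, j < n -> u j < 2) ->
  hi (f u) = (m <= num n 1 u).
Proof.
move=> Hu; pose s := [seq j <- iota 0 n | u j == 1].
have ss : size s = num n 1 u by rewrite size_filter.
have us : uniq s by rewrite filter_uniq ?iota_uniq.
have ms j : j < n -> (j \in s) = (u j == 1).
  by move=> lj; rewrite mem_filter mem_iota leq0n add0n lj /= andbT.
have lts i : i < size s -> nth 0 s i < n.
  by move=> li; have := mem_nth 0 li; rewrite mem_filter mem_iota => /andP[_ /andP[]].
pose col i := mkseq (input_col m i) m.+2.
have colP i : i < m.+2 -> col i \in rcols (input_desc M m0).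
  by move=> li; apply/mapP; exists i => //; rewrite mem_iota.
have nth_col i j : j < m.+2 -> nth 0 (col i) j = input_col m i j.
  by move=> lj; rewrite nth_mkseq.
have [le_m|gt_m] := leqP m (num n 1 u).
  (* The first [m] ones get the columns 0 to [m - 1], which makes the first [m] rows singletons;
     further ones get column [m], nonzero only in row [m + 1]. *)
  pose q j := if u j == 1 then col (minn (index j s) m) else col m.+1.
  have Hq j : j < n -> q j \in rcols (input_desc M m0).
    by move=> _; rewrite /q; case: ifP => _; apply: colP; lia.
  have /and3P[_ _ /implyP H] := Hin Hq.
  move: H; rewrite nth_mkseq // => H.
  have -> : word n u = word n (fun j => nth 0 (q j) m.+1).
    apply: eq_word => j lj; rewrite /q; have := Hu j lj.
    have [E1 E2] : (m.+1 < m) = false /\ (m.+1 == m) = false by split; lia.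
    by case: eqP => uj _; rewrite nth_col // /input_col E1 E2; have := Hu j lj; lia.
  apply: H; apply/forallP => i; have li := ltn_ord i; rewrite nth_mkseq; last by move=> /=; lia.
  have -> : word n (fun j => nth 0 (q j) i) = word n (sing (nth 0 s i)); last first.
    by rewrite Hsing // lts // ss; lia.
  apply: eq_word => j lj; rewrite /q /sing; case: eqP => [uj|uj].
    rewrite nth_col ?/input_col ?li; last by lia.
    have js : j \in s by rewrite ms // uj.
    congr nat_of_bool; apply/eqP/eqP => [E|->].
      by rewrite -E [minn _ _](_ : _ = index j s) ?nth_index //; lia.
    by rewrite index_uniq // ?ss; lia.
  rewrite nth_col ?/input_col ?li; last by lia.
  case: eqP => [E|_]; first by lia.
  case: eqP => // E; case: uj; have := mem_nth 0 (_ : i < size s).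
  by rewrite -E ms // => /(_ _)/eqP->//; rewrite ss; lia.
(* Column 0 does not contribute to row [m], so the numbering starts at 1; there are fewer than [m]
   ones, so the indices stay below [m]. *)
pose q j := if u j == 1 then col (index j s).+1 else col m.+1.
have ilt j : j < n -> u j = 1 -> (index j s).+1 < m.+2.
  move=> lj uj; have : j \in s by rewrite ms // uj.
  by rewrite -index_mem ss; lia.
have Hq j : j < n -> q j \in rcols (input_desc M m0).
  by move=> lj; rewrite /q; case: eqP => uj; apply: colP => //; apply: ilt.
have /and3P[_ /implyP H _] := Hin Hq.
move: H; rewrite nth_mkseq // => H; apply/negbTE.
have -> : word n u = word n (fun j => nth 0 (q j) m).
  apply: eq_word => j lj; rewrite /q; have := Hu j lj.
  case: eqP => [uj|uj] _; rewrite nth_col // /input_col ltnn eqxx.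
    rewrite uj; have : j \in s by rewrite ms // uj.
    by rewrite -index_mem ss; lia.
  by have := Hu j lj; lia.
apply: H; apply/forallP => i; have li := ltn_ord i; apply/implyP => i0.
rewrite nth_mkseq; last by move=> /=; lia.
have [i_s|i_s] := ltnP i.-1 (size s).
  have -> : word n (fun j => nth 0 (q j) i) = word n (sing (nth 0 s i.-1)); last first.
    by rewrite Hsing // lts.
  apply: eq_word => j lj; rewrite /q /sing; case: eqP => [uj|uj].
    rewrite nth_col ?/input_col ?li; last by lia.
    have js : j \in s by rewrite ms // uj.
    congr nat_of_bool; apply/eqP/eqP => [E|->]; first by rewrite -E /= nth_index.
    by rewrite index_uniq //; lia.
  rewrite nth_col ?/input_col ?li; last by lia.
  case: eqP => [E|_]; first by lia.
  case: eqP => // E; case: uj; have := mem_nth 0 i_s.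
  by rewrite -E ms // => /eqP->.
have -> : word n (fun j => nth 0 (q j) i) = word n (fun=> 0).
  apply: eq_word => j lj; rewrite /q; case: eqP => uj.
    rewrite nth_col ?/input_col ?li; last by lia.
    have : j \in s by rewrite ms // uj.
    rewrite -index_mem => j_s; case: eqP => // E.
    by move: i_s; rewrite -E leqNgt j_s.
  by rewrite nth_col ?/input_col ?li; lia.
by rewrite forced_zero.
Qed.

(** Induction on the number of twos. The state is claimed only for words without ones: the rule for
    other words reads it off [l0], where the ones are erased. *)
Lemma forced_run c u : (forall j, j < n -> u j < 3) -> num n 2 u = c ->
  (forall j, vb (f u) j = (num n 1 u < (run M m c).2 j)) /\
  (num n 1 u = 0 -> vq (f u) = (run M m c).1).
Proof.
elim: c u => [|c IH] u u3 Hc.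
  have u2 j : j < n -> u j < 2.
    by move=> lj; have := num_eq0 Hc lj; have := u3 j lj; lia.
  have := forced_input u2; have := forced_bin u2; rewrite /run /=.
  case: (f u) => // d _ /= ->; split=> // j.
  by case: eqP => //= _; rewrite -ltnNge.
(* Changing the two at [x] to zero or one goes back one step in time. *)
have [|x lx ux] := @num_gt0 n 2 u; first by rewrite Hc.
have uxE y v : num n y (upd u x v) + (2 == y) = num n y u + (v == y).
  by rewrite -ux num_upd.
have v0_3 v : v < 3 -> forall j, j < n -> upd u x v j < 3.
  by move=> v3 j lj; rewrite /upd; case: ifP => // _; exact: u3.
have [|b0 q0] := IH (upd u x 0) (v0_3 0 isT); first by have := uxE 2 0; rewrite /=; lia.
have [|b1 _] := IH (upd u x 1) (v0_3 1 isT); first by have := uxE 2 1; rewrite /=; lia.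
have N0 : num n 1 (upd u x 0) = num n 1 u by have := uxE 1 0; rewrite /=; lia.
have N1 : num n 1 (upd u x 1) = (num n 1 u).+1 by have := uxE 1 1; rewrite /=; lia.
rewrite N0 in b0 q0; rewrite N1 in b1.
have [a0|a_gt0] := posnP (num n 1 u).
  pose q j := if j == x then [:: 0; 1; 2; 1]
              else if u j == 2 then [:: 2; 2; 2; 0] else [:: 0; 0; 0; 0].
  have /forced_window0 : forall j, j < n ->
      q j \in [:: [:: 0; 0; 0; 0]; [:: 2; 2; 2; 0]; [:: 0; 1; 2; 1]].
    by move=> j _; rewrite /q; do 2?case: ifP => _; rewrite !inE eqxx ?orbT.
  have u01 j : j < n -> u j = 2 \/ u j = 0.
    by move=> lj; have := num_eq0 a0 lj; have := u3 j lj; lia.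
  have -> : word n (fun j => nth 0 (q j) 0) = word n (upd u x 0).
    by apply: eq_word => j lj; rewrite /q /upd; case: ifP => // _; case: (u01 j lj) => ->.
  have -> : word n (fun j => nth 0 (q j) 1) = word n (upd u x 1).
    by apply: eq_word => j lj; rewrite /q /upd; case: ifP => // _; case: (u01 j lj) => ->.
  have -> : word n (fun j => nth 0 (q j) 2) = word n u.
    apply: eq_word => j lj; rewrite /q; case: eqP => [->|_]; first by rewrite ux.
    by case: (u01 j lj) => ->.
  have -> : word n (fun j => nth 0 (q j) 3) = word n (sing x).
    by apply: eq_word => j lj; rewrite /q /sing; case: ifP => // _; case: ifP.
  rewrite /window0_ok Hsing // eqxx /= q0 // => /andP[/eqP Eq /forallP Eb].
  split=> [j|_]; last by rewrite Eq run_next_q; apply: eq_next_q => i; rewrite b0 a0.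
  by rewrite (eqP (Eb j)) run_next_b b0 b1 a0.
have [y ly uy] := num_gt0 a_gt0.
have xy : x <> y by move=> E; rewrite -E ux in uy.
(* Position [x] receives the new two, and position [y] carries the one that is missing in the word
   of [lm]. *)
pose q j := if j == x then [:: 0; 0; 0; 1; 2; 0; 1]
            else if j == y then [:: 0; 0; 1; 1; 1; 1; 0]
            else if u j == 2 then [:: 2; 2; 2; 2; 2; 0; 0]
            else if u j == 1 then [:: 0; 1; 1; 1; 1; 0; 0]
            else [:: 0; 0; 0; 0; 0; 0; 0].
have /forced_window : forall j, j < n ->
    q j \in [:: [:: 0; 0; 0; 0; 0; 0; 0]; [:: 0; 1; 1; 1; 1; 0; 0];
                    [:: 2; 2; 2; 2; 2; 0; 0]; [:: 0; 0; 1; 1; 1; 1; 0];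
                    [:: 0; 0; 0; 1; 2; 0; 1]].
  by move=> j _; rewrite /q; do 4?case: ifP => _; rewrite !inE eqxx ?orbT.
have u012 j : j < n -> [\/ u j = 2, u j = 1 | u j = 0].
  move=> /u3; case: (u j) => [|[|[|]]] // _; by [apply: Or33 | apply: Or32 | apply: Or31].
pose w0 j := nth 0 (q j) 0.
have [||bw0 qw0] := IH w0.
- by move=> j _; rewrite /w0 /q; do 4?case: ifP => _.
- have <- : num n 2 (upd u x 0) = c by have := uxE 2 0; rewrite /=; lia.
  apply: eq_num => j lj; rewrite /w0 /q /upd; case: ifP => // _.
  by case: (eqVneq j y) => [->|_]; [rewrite uy | case: (u012 j lj) => ->].
have {}qw0 := qw0 _.
have Nw0 : num n 1 w0 = 0.
  rewrite /num (@eq_in_count _ _ pred0) ?count_pred0 // => j _.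
  by rewrite /w0 /q /=; do 4?case: ifP => _.
pose wm := upd (upd u x 0) y 0.
have wmE v : num n v wm + (1 == v) = num n v (upd u x 0) + (0 == v).
  by rewrite -(num_upd v _ 0 ly) upd_other ?uy //; exact: nesym.
have [||bm _] := IH wm.
- by move=> j lj; rewrite /wm /upd; do 2?case: ifP => // _; exact: u3.
- by have := wmE 2; have := uxE 2 0; rewrite /=; lia.
have Nm : num n 1 wm = (num n 1 u).-1 by have := wmE 1; rewrite /= N0; lia.
have -> : word n (fun j => nth 0 (q j) 1) = word n wm.
  apply: eq_word => j lj; rewrite /q /wm /upd; case: (eqVneq j x) => [->|_].
    by case: eqP.
  by case: ifP => // _; case: (u012 j lj) => ->.
have -> : word n (fun j => nth 0 (q j) 2) = word n (upd u x 0).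
  apply: eq_word => j lj; rewrite /q /upd; case: ifP => // _.
  by case: eqP => [->|_]; [rewrite uy | case: (u012 j lj) => ->].
have -> : word n (fun j => nth 0 (q j) 3) = word n (upd u x 1).
  apply: eq_word => j lj; rewrite /q /upd; case: ifP => // _.
  by case: eqP => [->|_]; [rewrite uy | case: (u012 j lj) => ->].
have -> : word n (fun j => nth 0 (q j) 4) = word n u.
  apply: eq_word => j lj; rewrite /q; case: eqP => [->|_]; first by rewrite ux.
  by case: eqP => [->|_]; [rewrite uy | case: (u012 j lj) => ->].
have -> : word n (fun j => nth 0 (q j) 5) = word n (sing y).
  apply: eq_word => j lj; rewrite /q /sing; case: (eqVneq j x) => [->|_].
    by case: eqP.
  by case: ifP => // _; case: (u012 j lj) => ->.
have -> : word n (fun j => nth 0 (q j) 6) = word n (sing x).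
  by apply: eq_word => j lj; rewrite /q /sing; do 4?case: ifP => // _.
rewrite -/w0 /window_ok !Hsing // eqxx /= qw0 // => /forallP Eb.
split=> [j|]; last by lia.
by rewrite (eqP (Eb j)) run_next_b bm b0 b1 Nm eqn0Ngt a_gt0.
Qed.
End Forcing.

(** * Singletons of WNU and cyclic polymorphisms *)

Lemma wnu_singles (M : machine) c2 n (phi : n.-tuple 'I_3 -> label M) :
  allp (sat phi) (common_descs M false c2) -> 1 < n -> wnu_fun phi ->
  forall i, i < n -> kind (phi (word n (sing i))) = 1.
Proof.
move=> Hcom n1 W.
have E i : i < n -> phi (word n (sing i)) = phi (word n (sing 0)).
  move=> li; have := W (inord 0) (inord 1) (Ordinal li) (Ordinal (ltnW n1)).
  congr (phi _ = phi _); apply: eq_from_tnth => j; rewrite !tnth_mktuple -val_eqE /sing /=;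
    by case: eqP.
have := singles_kind Hcom n1 (k := kind (phi (word n (sing 0)))) _ _.
move=> H i li; rewrite E // H // => {}i {}li; by rewrite E.
Qed.

Lemma rotr_word n u : rotr_tuple 1 (word n.+1 u) =
  word n.+1 (fun j => u (if j == 0 then n else j.-1)).
Proof.
apply: eq_from_tnth => j; rewrite tnth_mktuple (tnth_nth ord0) /=.
rewrite /rotr size_map size_enum_ord subn1 /= /rot nth_cat.
have sz : size [seq (inord (u i) : 'I_3) | i : 'I_n.+1 <- enum 'I_n.+1] = n.+1.
  by rewrite size_map size_enum_ord.
have nthE k : k < n.+1 ->
    nth ord0 [seq (inord (u i) : 'I_3) | i : 'I_n.+1 <- enum 'I_n.+1] k = inord (u k).
  by move=> lk; rewrite (nth_map ord0) ?size_enum_ord // nth_enum_ord.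
rewrite size_drop sz subSnn ltnS leqn0.
case: eqP => [->|/eqP j0]; first by rewrite nth_drop addn0 nthE.
have lj := ltn_ord j; rewrite nth_take ?nthE ?subn1 //; lia.
Qed.

Definition shift n (i : nat) : nat := if i == n then 0 else i.+1.

Definition pair_word (i j : nat) : nat -> nat :=
  fun k => if k == i then 2 else if k == j then 1 else 0.

Section CyclicSingles.
Variables (M : machine) (c2 : bool) (n : nat).
Variable phi : n.+1.-tuple 'I_3 -> label M.
Hypothesis Hcom : allp (sat phi) (common_descs M true c2).
Hypothesis Hcyc : allp (sat phi) (cyclic_descs M).
Hypothesis phi_cyc : cyclic_fun phi.

Local Notation f u := (phi (word n.+1 u)).

Lemma cyc_sing i : i < n.+1 -> f (sing i) = f (sing 0).
Proof.
elim: i => // i IH li; rewrite -IH ?(ltnW li) // [in RHS]phi_cyc rotr_word.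
by congr phi; apply: eq_word => j lj; rewrite /sing; congr nat_of_bool; case: ifP; lia.
Qed.

Lemma cyc_pair i j : i < n.+1 -> j < n.+1 ->
  f (pair_word (shift n i) (shift n j)) = f (pair_word i j).
Proof.
move=> li lj; rewrite [in RHS]phi_cyc rotr_word; congr phi; apply: eq_word => k lk.
rewrite /pair_word /shift.
have E x : x < n.+1 -> (k == (if x == n then 0 else x.+1)) =
    ((if k == 0 then n else k.-1) == x).
  by move=> lx; case: (eqVneq x n) => ?; case: (eqVneq k 0) => ?; lia.
by rewrite !E.
Qed.

Lemma lt_asym i j : i < n.+1 -> j < n.+1 -> i <> j ->
  ~~ (vlt (f (pair_word i j)) && vlt (f (pair_word j i))).
Proof.
move=> li lj ij; case: Hcyc => s _.
pose q k := if k == i then [:: 2; 1] else if k == j then [:: 1; 2] else [:: 0; 0].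
have := s q; rewrite /=.
have -> : word n.+1 (fun k => nth 0 (q k) 0) = word n.+1 (pair_word i j).
  by apply: eq_word => k _; rewrite /q /pair_word; do 2?case: ifP => // _.
have -> : word n.+1 (fun k => nth 0 (q k) 1) = word n.+1 (pair_word j i).
  apply: eq_word => k _; rewrite /q /pair_word.
  by case: (eqVneq k i) => [->|_]; [case: eqP | do 2?case: ifP => // _].
by apply=> k _; rewrite /q; do 2?case: ifP => _; rewrite !inE eqxx ?orbT.
Qed.

Lemma lt_trans i j k : i <> j -> j <> k -> i <> k ->
  vlt (f (pair_word i j)) -> vlt (f (pair_word j k)) -> vlt (f (pair_word i k)).
Proof.
move=> ij jk ik; case: Hcyc => _ [s _].
pose q x := if x == i then [:: 2; 0; 2] else if x == j then [:: 1; 2; 0]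
            else if x == k then [:: 0; 1; 1] else [:: 0; 0; 0].
have := s q; rewrite /=.
have -> : word n.+1 (fun x => nth 0 (q x) 0) = word n.+1 (pair_word i j).
  by apply: eq_word => x _; rewrite /q /pair_word; do 3?case: ifP => // _.
have -> : word n.+1 (fun x => nth 0 (q x) 1) = word n.+1 (pair_word j k).
  apply: eq_word => x _; rewrite /q /pair_word.
  case: (eqVneq x i) => [->|_]; last by do 3?case: ifP => // _.
  by case: eqP => //; case: eqP.
have -> : word n.+1 (fun x => nth 0 (q x) 2) = word n.+1 (pair_word i k).
  apply: eq_word => x _; rewrite /q /pair_word.
  case: ifP => // _; case: (eqVneq x j) => [->|_]; last by case: ifP.
  by case: eqP.
move=> + Hij Hjk; rewrite Hij Hjk; apply=> x _.
by rewrite /q; do 3?case: ifP => _; rewrite !inE eqxx ?orbT.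
Qed.

(* The relation "smaller" on the coordinates is a strict order that is invariant
   under a transitive rotation, so it is empty: otherwise the number of
   predecessors would increase along a pair. *)
Lemma lt_empty i j : i < n.+1 -> j < n.+1 -> i <> j -> vlt (f (pair_word i j)) = false.
Proof.
pose L (i j : 'I_n.+1) := (i != j) && vlt (f (pair_word i j)).
have Lasym x y : L x y -> L y x -> False.
  move=> /andP[/eqP xy Lxy] /andP[_ Lyx].
  have := @lt_asym x y (ltn_ord x) (ltn_ord y); rewrite Lxy Lyx /=.
  by case/(_ _)=> // E; apply: xy; exact: val_inj.
have Ltrans x y z : L x y -> L y z -> L x z.
  move=> Lxy Lyz; have [xz|xz] := eqVneq x z; first by case: (Lasym _ _ Lxy); rewrite xz.
  case/andP: Lxy => /eqP xy Hxy; case/andP: Lyz => /eqP yz Hyz.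
  rewrite /L xz; apply: lt_trans Hxy Hyz.
  - by move=> E; apply: xy; exact: val_inj.
  - by move=> E; apply: yz; exact: val_inj.
  - by move=> E; move/eqP: xz; apply; exact: val_inj.
pose sh (x : 'I_n.+1) : 'I_n.+1 := inord (shift n x).
have shE x : sh x = shift n x :> nat.
  by rewrite /sh inordK // /shift; have := ltn_ord x; case: eqP; lia.
have sh_inj : injective sh.
  move=> x y /(congr1 val); rewrite /= !shE /shift => E; apply: ord_inj.
  by move: E; case: (eqVneq (x : nat) n) => ?; case: (eqVneq (y : nat) n) => ?; lia.
have Lsh x y : L (sh x) (sh y) = L x y.
  by rewrite /L (inj_eq sh_inj) !shE cyc_pair.
pose P x := \sum_y (L y x : nat).
have Psh x : P (sh x) = P x.
  by rewrite /P (reindex_inj sh_inj); apply: eq_bigr => y _; rewrite Lsh.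
have P0 k : k < n.+1 -> P (inord k) = P ord0.
  elim: k => [_|k IH lk]; first by congr P; apply: val_inj; rewrite /= inordK.
  rewrite -IH 1?ltnW // -[in RHS]Psh; congr P; apply: ord_inj.
  rewrite shE !inordK ?(ltnW lk) // /shift; case: eqP => // E; lia.
move=> li lj ij; apply/negP => Lij.
have {}Lij : L (inord i) (inord j).
  by rewrite /L -val_eqE /= !inordK // Lij andbT; apply/eqP.
have : P (inord i) < P (inord j).
  rewrite /P (bigD1 (inord i)) //= [X in _ < X](bigD1 (inord i)) //= Lij /L eqxx /=.
  rewrite add0n add1n ltnS; apply: leq_sum => y _.
  case H : (_ && _) => //; rewrite -/(L _ _) in H.
  by have := Ltrans _ _ _ H Lij; rewrite /L => ->.
by rewrite !P0 // ltnn.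
Qed.

Lemma cyc_singles : 1 < n.+1 -> forall i, i < n.+1 -> kind (f (sing i)) = 1.
Proof.
move=> n1.
(* The only one of [w t] is at position 0; the twos start at [t], with zeros in between. Raising [t]
   turns the twos to zeros one at a time. *)
pose w t k := if k == 0 then 1 else if t <= k then 2 else 0.
have dv t : 0 < t <= n.+1 -> vdv (f (w t)).
  case: t => // t; elim: t => [_|t IH lt].
    case: Hcyc => _ [_ [_ [s _]]]; apply: (s (fun k => [:: w 1 k])) => k _ /=.
    by rewrite /w; case: k.
  case: Hcyc => _ [_ [s _]].
  pose q k := if k == 0 then [:: 1; 1; 1; 2] else if k == t.+1 then [:: 0; 2; 2; 1]
     else if t.+1 < k then [:: 2; 2; 0; 0] else [:: 0; 0; 0; 0].
  have := s q; rewrite /=.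
  have -> : word n.+1 (fun x => nth 0 (q x) 0) = word n.+1 (w t.+2).
    apply: eq_word => x _; rewrite /q /w; case: ifP => // _.
    by case: (eqVneq x t.+1) => [->|_]; [rewrite ltnn | case: ifP].
  have -> : word n.+1 (fun x => nth 0 (q x) 1) = word n.+1 (w t.+1).
    apply: eq_word => x _; rewrite /q /w; case: ifP => // _.
    case: (eqVneq x t.+1) => [->|xt]; first by rewrite leqnn.
    by rewrite [t < x]leq_eqVlt eq_sym (negbTE xt) /=; case: ifP.
  have -> : word n.+1 (fun x => nth 0 (q x) 2) = word n.+1 (pair_word t.+1 0).
    apply: eq_word => x _; rewrite /q /pair_word.
    case: (eqVneq x 0) => [->|_] //; case: (eqVneq x t.+1) => // _; by case: ifP.
  have -> : word n.+1 (fun x => nth 0 (q x) 3) = word n.+1 (pair_word 0 t.+1).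
    apply: eq_word => x _; rewrite /q /pair_word.
    by do 3?case: ifP => // _.
  case/andP: lt => _ lt.
  rewrite !lt_empty //= IH ?(ltnW lt) //; apply=> x _.
  by rewrite /q; do 3?case: ifP => _; rewrite !inE eqxx ?orbT.
have := dv n.+1; rewrite ltn0Sn leqnn => /(_ isT).
have -> : word n.+1 (w n.+1) = word n.+1 (sing 0).
  by apply: eq_word => k lk; rewrite /w /sing leqNgt lk /=; case: eqP.
have : is_bin (f (sing 0)).
  by apply: (forced_bin Hcom) => j _; rewrite /sing; case: eqP.
(* On a binary label, [vdv] means that the kind is not 2, the value that [plus_ok] does not exclude
   in the cyclic case. *)
move=> Hb Hd; have k2 : kind (f (sing 0)) != 2.
  by move: Hb Hd; case: (f (sing 0)).
have H := singles_kind Hcom n1 (k := kind (f (sing 0))).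
move=> i li; rewrite cyc_sing // H //; first by move=> k lk; rewrite cyc_sing.
by move=> E; rewrite E in k2.
Qed.
End CyclicSingles.

(** * Construction of polymorphisms *)

Definition wnum n (x : nat) (w : n.-tuple 'I_3) : nat := count (fun l : 'I_3 => l == x :> nat) w.

Lemma wnum_word n x u : (forall j, j < n -> u j < 3) -> wnum x (word n u) = num n x u.
Proof.
move=> u3; rewrite /wnum /word /= count_map num_sum -sum1_count big_mkcond /=.
rewrite big_enum /=; apply: eq_bigr => j _.
by rewrite inordK ?u3 //; case: eqP.
Qed.

Lemma num_add n x y z u v w :
  (forall j, j < n -> (u j == x : nat) = (v j == y) + (w j == z)) ->
  num n x u = num n y v + num n z w.
Proof. by move=> E; rewrite !num_sum -big_split; apply: eq_bigr => j _; exact: E. Qed.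

Lemma num_const n x u : (forall j, j < n -> u j = x) -> num n x u = n.
Proof.
move=> E; rewrite num_sum (eq_bigr (fun=> 1)) ?sum1_card ?card_ord // => j _.
by rewrite E ?eqxx.
Qed.

Lemma num_none n x u : (forall j, j < n -> u j <> x) -> num n x u = 0.
Proof. by move=> E; rewrite num_sum big1 // => j _; case: eqP => // /(E _ (ltn_ord j)). Qed.

Lemma num_total n u : num n 1 u + num n 2 u <= n.
Proof.
rewrite !num_sum -big_split /= -[X in _ <= X]card_ord -sum1_card; apply: leq_sum => j _ /=.
by case: (u j) => [|[|[|]]].
Qed.

Lemma num_first n x u : 0 < n -> (u 0 == x) <= num n x u.
Proof. by move=> n0; rewrite num_sum (bigD1 (Ordinal n0)) //= leq_addr. Qed.

Lemma num_not_first n x u : 0 < n -> num n x u + (u 0 != x) <= n.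
Proof.
move=> n0; rewrite num_sum -[X in _ <= X]card_ord -sum1_card.
rewrite (bigD1 (Ordinal n0)) //= [X in _ <= X](bigD1 (Ordinal n0)) //=.
rewrite -addnA [X in _ + X]addnC addnA leq_add //; first by case: eqP.
by apply: leq_sum => j _; case: eqP.
Qed.

Section Existence.
Variables (M : machine) (m : nat) (cyc c2 : bool) (n : nat).
Hypotheses (n1 : 1 < n) (n_cyc : cyc -> prime n) (n_wnu : ~~ cyc -> 2 < n).

(** [a] is the number of ones and [b] says whether position 0, the dictator of the WNU case, is
    among them. Sizes 1 and [n - 1] ignore the dictator, as the WNU identities demand; in the cyclic
    case only the size counts. *)
Definition ex_kind (a : nat) (b : bool) : nat :=
  if a == 0 then 0 else if a == 1 then 1 else if a == n then 3
  else if [|| cyc, a == n.-1 | ~~ b] then 2 else 3.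

Lemma ex_kind0 a b : (ex_kind a b == 0) = (a == 0).
Proof. by rewrite /ex_kind; do 4?case: ifP => // _. Qed.

Lemma ex_kind1 a b : (ex_kind a b == 1) = (a == 1).
Proof.
by rewrite /ex_kind; case: (eqVneq a 0) => [->|_] //; do 3?case: ifP => // _.
Qed.

Lemma ex_kind2 a b : (ex_kind a b == 2) =
  [&& 1 < a, a != n & [|| cyc, a == n.-1 | ~~ b]].
Proof.
rewrite /ex_kind; case: (eqVneq a 0) => [->|a0] //; case: (eqVneq a 1) => [->|a1] //.
have -> : 1 < a by lia.
by case: (eqVneq a n) => //= _; case: ifP.
Qed.

Lemma ex_kind3 a b : (ex_kind a b == 3) =
  (1 < a) && ((a == n) || ~~ [|| cyc, a == n.-1 | ~~ b]).
Proof.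
rewrite /ex_kind; case: (eqVneq a 0) => [->|a0] //; case: (eqVneq a 1) => [->|a1] //.
have -> : 1 < a by lia.
by case: (eqVneq a n) => //= _; case: ifP.
Qed.

Lemma ex_kind_lt a b : ex_kind a b < 4.
Proof. by rewrite /ex_kind; do 4?case: ifP => // _. Qed.

Definition ex_label (a c : nat) (b : bool) : label M :=
  if c == 0 then inl (inord (ex_kind a b * 2 + (m <= a)))
  else inr ((run M m c).1, [ffun j => a < (run M m c).2 j], c < a,
            (a == 0) || (a %| n - a - c)).

Lemma ex_digit a b : nat_of_ord (inord (ex_kind a b * 2 + (m <= a)) : 'I_8) =
  ex_kind a b * 2 + (m <= a).
Proof. by rewrite inordK //; have := ex_kind_lt a b; have := leq_b1 (m <= a); lia. Qed.

Lemma kind_ex a c b : kind (ex_label a c b) = if c == 0 then ex_kind a b else 4.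
Proof.
rewrite /ex_label; case: eqP => //= _; rewrite ex_digit divnMDl // divn_small ?addn0 //.
by have := leq_b1 (m <= a); lia.
Qed.

Lemma is_bin_ex a c b : is_bin (ex_label a c b) = (c == 0).
Proof. by rewrite /ex_label; case: eqP. Qed.

Lemma hi_ex a b : hi (ex_label a 0 b) = (m <= a).
Proof. by rewrite /= ex_digit oddD oddM andbF /= oddb. Qed.

Lemma vq_ex a c b : vq (ex_label a c b) = (run M m c).1.
Proof. by rewrite /ex_label; case: eqP => [->|]. Qed.

Lemma vb_ex a c b j : vb (ex_label a c b) j = (a < (run M m c).2 j).
Proof.
rewrite /ex_label; case: eqP => [->|_] /=; last by rewrite ffunE.
rewrite ex_digit oddD oddM andbF oddb /= /run /=; case: eqP => //= _.
by rewrite ltnNge.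
Qed.

Lemma vlt_ex a c b : vlt (ex_label a c b) = (0 < c) && (c < a).
Proof. by rewrite /ex_label lt0n; case: eqP. Qed.

Lemma vdv_ex a c b : vdv (ex_label a c b) =
  if c == 0 then ex_kind a b != 2 else (a == 0) || (a %| n - a - c).
Proof.
rewrite /ex_label; case: eqP => //= _; rewrite ex_digit divnMDl // divn_small ?addn0 //.
by have := leq_b1 (m <= a); lia.
Qed.

Definition ex_phi (w : n.-tuple 'I_3) : label M :=
  ex_label (wnum 1 w) (wnum 2 w) (nth ord0 w 0 == 1 :> nat).

Lemma ex_phi_word u : (forall j, j < n -> u j < 3) ->
  ex_phi (word n u) = ex_label (num n 1 u) (num n 2 u) (u 0 == 1).
Proof.
move=> u3; rewrite /ex_phi !wnum_word //; congr ex_label.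
have n0 : 0 < n by lia.
by rewrite -(tnth_nth _ _ (Ordinal n0)) tnth_mktuple inordK // u3.
Qed.

Lemma ex_phi_row q i : (forall j, j < n -> nth 0 (q j) i < 3) ->
  ex_phi (word n (fun j => nth 0 (q j) i)) =
  ex_label (num n 1 (fun j => nth 0 (q j) i)) (num n 2 (fun j => nth 0 (q j) i))
           (nth 0 (q 0) i == 1).
Proof. exact: ex_phi_word. Qed.

Hypothesis ex_out :
  if c2 then (run M m n).1 = mZ M else forall c, (run M m c).1 <> mN M.

Ltac by_cols Hq :=
  let j := fresh "j" in
  move=> j /Hq; rewrite /= ?inE; repeat (case/orP); by move/eqP->.

Lemma ex_sat_common : allp (sat ex_phi) (common_descs M cyc c2).
Proof.
have n0 : 0 < n by lia.
split; [|split; [|split; [|split; [|split; [|split; [|split; [|split]]]]]]] => //=.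
- move=> q Hq; rewrite /= ex_phi_row; last by by_cols Hq.
  by rewrite is_bin_ex num_none //; by_cols Hq.
- move=> q Hq; rewrite /= ex_phi_row; last by by_cols Hq.
  by rewrite kind_ex !num_none //; by_cols Hq.
- move=> q Hq; rewrite /= ex_phi_row; last by by_cols Hq.
  rewrite kind_ex [num n 2 _]num_none ?[num n 1 _]num_const; [|by by_cols Hq..].
  by rewrite /= ex_kind3 eqxx n1.
- move=> q Hq; rewrite /= !ex_phi_row; [|by by_cols Hq..].
  rewrite /plus_ok !kind_ex ![num n 2 _]num_none /=; [|by by_cols Hq..].
  set a0 := num n 1 (fun j => nth 0 (q j) 0); set a1 := num n 1 (fun j => nth 0 (q j) 1).
  have -> : num n 1 (fun j => nth 0 (q j) 2) = a0 + a1.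
    by apply: num_add; by_cols Hq.
  have le : a0 + a1 <= n.
    have <- : num n 1 (fun j => nth 0 (q j) 2) = a0 + a1 by apply: num_add; by_cols Hq.
    by have := num_total n (fun j => nth 0 (q j) 2); lia.
  (* A set containing position 0 is nonempty and a set avoiding it is not full; with these bounds
     the rules on kinds become linear arithmetic. *)
  have f0 : (nth 0 (q 0) 0 == 1) <= a0 by exact: (num_first 1 (fun j => nth 0 (q j) 0)).
  have f1 : (nth 0 (q 0) 1 == 1) <= a1 by exact: (num_first 1 (fun j => nth 0 (q j) 1)).
  have g0 : a0 + (nth 0 (q 0) 0 != 1) <= n.
    exact: (num_not_first 1 (fun j => nth 0 (q j) 0)).
  have g1 : a1 + (nth 0 (q 0) 1 != 1) <= n.
    exact: (num_not_first 1 (fun j => nth 0 (q j) 1)).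
  have g2 : a0 + a1 + (nth 0 (q 0) 2 != 1) <= n.
    have <- : num n 1 (fun j => nth 0 (q j) 2) = a0 + a1 by apply: num_add; by_cols Hq.
    exact: (num_not_first 1 (fun j => nth 0 (q j) 2)).
  have E : (nth 0 (q 0) 2 == 1 : nat) = (nth 0 (q 0) 0 == 1) + (nth 0 (q 0) 1 == 1).
    by move: (Hq 0 n0); rewrite /= !inE; repeat case/orP; move/eqP->.
  rewrite !ex_kind0 !ex_kind2 !ex_kind3.
  move: f0 f1 g0 g1 g2 E n_wnu.
  case: (nth 0 (q 0) 0 == 1); case: (nth 0 (q 0) 1 == 1); case: (nth 0 (q 0) 2 == 1);
    case: cyc => //=; lia.
- move=> q Hq; rewrite /= !ex_phi_row; [|by by_cols Hq..].
  rewrite /window0_ok !kind_ex.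
  have -> : num n 2 (fun j => nth 0 (q j) 3) = 0 by apply: num_none; by_cols Hq.
  rewrite /= ex_kind1 !vq_ex; apply/implyP => /eqP E1.
  (* Exactly one coordinate has chosen the last column, so the number of twos grows by one. *)
  have c0' : num n 2 (fun j => nth 0 (q j) 2) = (num n 2 (fun j => nth 0 (q j) 0)).+1.
    have -> : num n 2 (fun j => nth 0 (q j) 2) =
        num n 2 (fun j => nth 0 (q j) 0) + num n 1 (fun j => nth 0 (q j) 3).
      by apply: num_add; by_cols Hq.
    by rewrite E1 addn1.
  have c1 : num n 2 (fun j => nth 0 (q j) 1) = num n 2 (fun j => nth 0 (q j) 0).
    by apply: eq_num; by_cols Hq.
  have a0 : num n 1 (fun j => nth 0 (q j) 0) = 0 by apply: num_none; by_cols Hq.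
  have a1 : num n 1 (fun j => nth 0 (q j) 1) = 1.
    by apply: etrans E1; apply: eq_num; by_cols Hq.
  have a2 : num n 1 (fun j => nth 0 (q j) 2) = 0 by apply: num_none; by_cols Hq.
  apply/andP; split.
    by rewrite c0' run_next_q; apply/eqP/eq_next_q => i; rewrite vb_ex a0.
  by apply/forallP => j; rewrite !vb_ex c0' c1 a0 a1 a2 run_next_b.
- move=> q Hq; rewrite /= !ex_phi_row; [|by by_cols Hq..].
  rewrite /window_ok !kind_ex.
  have -> : num n 2 (fun j => nth 0 (q j) 5) = 0 by apply: num_none; by_cols Hq.
  have -> : num n 2 (fun j => nth 0 (q j) 6) = 0 by apply: num_none; by_cols Hq.
  rewrite /= !ex_kind1 !vq_ex; apply/implyP => /andP[/eqP E5 /eqP E6].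
  set c := num n 2 (fun j => nth 0 (q j) 0).
  have k1 : num n 2 (fun j => nth 0 (q j) 1) = c by apply: eq_num; by_cols Hq.
  have k2 : num n 2 (fun j => nth 0 (q j) 2) = c by apply: eq_num; by_cols Hq.
  have k3 : num n 2 (fun j => nth 0 (q j) 3) = c by apply: eq_num; by_cols Hq.
  have k4 : num n 2 (fun j => nth 0 (q j) 4) = c.+1.
    have -> : num n 2 (fun j => nth 0 (q j) 4) =
        c + num n 1 (fun j => nth 0 (q j) 6).
      by apply: num_add; by_cols Hq.
    by rewrite E6 addn1.
  set a := num n 1 (fun j => nth 0 (q j) 1).
  have a2 : num n 1 (fun j => nth 0 (q j) 2) = a.+1.
    have -> : num n 1 (fun j => nth 0 (q j) 2) =
        a + num n 1 (fun j => nth 0 (q j) 5).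
      by apply: num_add; by_cols Hq.
    by rewrite E5 addn1.
  have a3 : num n 1 (fun j => nth 0 (q j) 3) = a.+2.
    have -> : num n 1 (fun j => nth 0 (q j) 3) =
        num n 1 (fun j => nth 0 (q j) 2) + num n 1 (fun j => nth 0 (q j) 6).
      by apply: num_add; by_cols Hq.
    by rewrite a2 E6 addn1.
  have a4 : num n 1 (fun j => nth 0 (q j) 4) = a.+1.
    by rewrite -a2; apply: eq_num; by_cols Hq.
  by apply/forallP => j; rewrite !vb_ex k1 k2 k3 k4 a2 a3 a4 run_next_b.
- case: c2 ex_out => Ho q Hq; rewrite /= ex_phi_row ?vq_ex; try by by_cols Hq.
    by rewrite num_const ?Ho ?eqxx //; by_cols Hq.
  by apply/eqP.
- by move=> q Hq; have := Hq 0 n0; rewrite /= in_nil.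
Qed.

Lemma ex_sat_cyclic : cyc -> allp (sat ex_phi) (cyclic_descs M).
Proof.
move=> cycT; have pn := n_cyc cycT.
split; [|split; [|split; [|split]]] => //.
- move=> q Hq; rewrite /= !ex_phi_row; [|by by_cols Hq..].
  rewrite !vlt_ex.
  have -> : num n 1 (fun j => nth 0 (q j) 1) = num n 2 (fun j => nth 0 (q j) 0).
    by apply: eq_num; by_cols Hq.
  have -> : num n 2 (fun j => nth 0 (q j) 1) = num n 1 (fun j => nth 0 (q j) 0).
    by apply: eq_num; by_cols Hq.
  lia.
- move=> q Hq; rewrite /= !ex_phi_row; [|by by_cols Hq..].
  rewrite !vlt_ex.
  have -> : num n 2 (fun j => nth 0 (q j) 2) = num n 2 (fun j => nth 0 (q j) 0).
    by apply: eq_num; by_cols Hq.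
  have -> : num n 1 (fun j => nth 0 (q j) 2) = num n 1 (fun j => nth 0 (q j) 1).
    by apply: eq_num; by_cols Hq.
  have -> : num n 2 (fun j => nth 0 (q j) 1) = num n 1 (fun j => nth 0 (q j) 0).
    by apply: eq_num; by_cols Hq.
  lia.
- move=> q Hq; rewrite /= !ex_phi_row; [|by by_cols Hq..].
  rewrite !vlt_ex !vdv_ex.
  set W := num n 1 (fun j => nth 0 (q j) 0); set V := num n 2 (fun j => nth 0 (q j) 0).
  set W' := num n 2 (fun j => nth 0 (q j) 2).
  have e1 : num n 1 (fun j => nth 0 (q j) 1) = W by apply: eq_num; by_cols Hq.
  have e2 : num n 2 (fun j => nth 0 (q j) 1) = V + W' by apply: num_add; by_cols Hq.
  have e3 : num n 1 (fun j => nth 0 (q j) 2) = W by apply: eq_num; by_cols Hq.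
  have e4 : num n 1 (fun j => nth 0 (q j) 3) = W' by apply: eq_num; by_cols Hq.
  have e5 : num n 2 (fun j => nth 0 (q j) 3) = W by apply: eq_num; by_cols Hq.
  have tot : W + (V + W') <= n.
    by rewrite -e1 -e2; exact: num_total.
  rewrite e1 e2 e3 e4 e5 !ex_kind2 cycT /=; apply/implyP => /and3P[H1 H2 H3].
  have [W0|W0] := posnP W; first by rewrite W0; case: eqP.
  (* For [W' = 0] both comparisons are false whatever [W] is, but then the premise and the
     conclusion on [vdv] concern the same counts. *)
  have [W'0|W'0] := posnP W'; first by move: H3; rewrite W'0 addn0 (gtn_eqF W0).
  have E : W' = W by lia.
  rewrite E in tot H3 *; have VW : (V + W == 0) = false by lia.
  rewrite VW (gtn_eqF W0) /= in H3; rewrite /=.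
  have dvd : W %| n - W - V.
    have -> : n - W - V = (n - W - (V + W)) + W by lia.
    by rewrite dvdn_add.
  (* Without twos the label is binary. By primality [W] is 1 or [n], and [n] is impossible because
     [W] further positions are disjoint from the ones. *)
  case: eqP => // V0; have : W %| n.
    have -> : n = (n - W - V) + W by lia.
    by rewrite dvdn_add.
  case/primeP: pn => _ H /H /orP[/eqP->//|/eqP Wn]; lia.
- move=> q Hq; rewrite /= ex_phi_row; last by by_cols Hq.
  rewrite vdv_ex ex_kind2.
  have tot : num n 1 (fun j => nth 0 (q j) 0) + num n 2 (fun j => nth 0 (q j) 0) = n.
    rewrite -[RHS](@num_const n 0 (fun=> 0)) //; symmetry.
    by apply: num_add; by_cols Hq.
  case: eqP => [E|_]; first by rewrite E addn0 in tot; rewrite tot eqxx andbF.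
  by rewrite -subnDA tot subnn dvdn0 orbT.
Qed.

Lemma ex_sat_input (m0 : 0 < m) : sat ex_phi (input_desc M m0).
Proof.
have n0 : 0 < n by lia.
move=> q Hq.
have colE j : j < n -> exists2 i, i < m.+2 & q j = mkseq (input_col m i) m.+2.
  by move=> /Hq /mapP[i]; rewrite mem_iota => li ->; exists i.
have q2 i j : j < n -> nth 0 (q j) i < 2.
  move=> /colE[k _ ->]; have [li|li] := ltnP i m.+2; last by rewrite nth_default ?size_mkseq.
  by rewrite nth_mkseq // /input_col; do 2?case: ifP => _; case: (X in nat_of_bool X).
have phiE i : ex_phi (word n (fun j => nth 0 (q j) i)) =
    ex_label (num n 1 (fun j => nth 0 (q j) i)) 0 (nth 0 (q 0) i == 1).
  rewrite ex_phi_row; last by move=> j /(q2 i); lia.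
  by rewrite [num n 2 _]num_none // => j /(q2 i); lia.
have sum_eq (i0 : nat) : \sum_(i < m) (i0 == i :> nat) = (i0 < m).
  have [lt|ge] := ltnP i0 m; last first.
    by rewrite big1 // => i _; case: eqP => // E; move: (ltn_ord i); rewrite -E ltnNge ge.
  rewrite (bigD1 (Ordinal lt)) //= eqxx big1 // => i.
  by rewrite -val_eqE /= eq_sym => /negbTE->.
apply/and3P; split.
- by apply/(all_nthP (lab0 M)) => i; rewrite size_mkseq => li;
     rewrite nth_mkseq // phiE is_bin_ex.
- rewrite nth_mkseq // phiE hi_ex -ltnNge; apply/implyP => /forallP H.
  (* The factor [0 < i] masks row 0, so that the sum over [m] rows is at most [m - 1]. *)
  have le1 (i : 'I_m) : (0 < i) * num n 1 (fun j => nth 0 (q j) i) <= (0 < i).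
    have := H i; case: (posnP i) => //= i0.
    rewrite nth_mkseq; last by have := ltn_ord i; move=> /=; lia.
    rewrite phiE kind_ex /= mul1n; set a := num _ _ _; set b := _ == 1 => lt2.
    by have := ex_kind0 a b; have := ex_kind1 a b; lia.
  have : num n 1 (fun j => nth 0 (q j) m) <=
      \sum_(i < m) (0 < i) * num n 1 (fun j => nth 0 (q j) i).
    under eq_bigr => i _ do rewrite num_sum big_distrr.
    rewrite num_sum exchange_big; apply: leq_sum => j _ /=.
    have [k _ ->] := colE j (ltn_ord j).
    rewrite nth_mkseq // /input_col ltnn eqxx.
    case H0 : (_ && _) => //=; case/andP: H0 => k0 km.
    rewrite (bigD1 (Ordinal km)) //= nth_mkseq; last by lia.
    by rewrite km eqxx k0.
  move=> le; apply: leq_ltn_trans le _.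
  have lt : \sum_(i < m) (0 < i : nat) < m.
    rewrite (bigD1 (Ordinal m0)) //= add0n.
    apply: (@leq_ltn_trans (\sum_(i < m | i != Ordinal m0) 1)).
      by apply: leq_sum => i _; case: (0 < i).
    by rewrite sum1_card cardC1 card_ord prednK.
  by apply: leq_ltn_trans lt; apply: leq_sum => i _; exact: le1.
rewrite nth_mkseq // phiE hi_ex; apply/implyP => /forallP H.
have eq1 (i : 'I_m) : num n 1 (fun j => nth 0 (q j) i) = 1.
  have := H i; rewrite nth_mkseq; last by have := ltn_ord i; move=> /=; lia.
  by rewrite phiE kind_ex /= ex_kind1 => /eqP.
have sumE : \sum_(i < m) num n 1 (fun j => nth 0 (q j) i) = m.
  by rewrite (eq_bigr (fun=> 1)) ?sum1_card ?card_ord.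
apply: leq_trans (eq_leq (esym sumE)) _.
under eq_bigr => i _ do rewrite num_sum.
rewrite exchange_big num_sum; apply: leq_sum => j _ /=.
have [k _ ->] := colE j (ltn_ord j).
rewrite nth_mkseq // /input_col.
have [-> ->] : (m.+1 < m) = false /\ (m.+1 == m) = false by split; lia.
rewrite (eq_bigr (fun i : 'I_m => nat_of_bool (k == i :> nat))).
  by rewrite sum_eq; case: (ltnP k m) => // /ltnW->.
by move=> i _; rewrite nth_mkseq ?ltn_ord ?eqb1 //; have := ltn_ord i; lia.
Qed.

Lemma ex_phi_cyclic : cyc -> cyclic_fun ex_phi.
Proof.
move=> cycT w; rewrite /ex_phi /ex_label /ex_kind cycT /=.
have E x : wnum x (rotr_tuple 1 w) = wnum x w.
  by apply/permP; rewrite /= perm_rotr.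
by rewrite !E.
Qed.

(** With one deviating letter, the number of ones is 0, 1, [n - 1] or [n], and for these sizes
    [ex_kind] ignores position 0; labels of words with twos depend only on the counts. *)
Lemma ex_phi_wnu : ~~ cyc -> wnu_fun ex_phi.
Proof.
move=> /n_wnu n3 x y i j; rewrite /ex_phi.
have E (k : 'I_n) z : wnum z [tuple if l == k then y else x | l < n] =
    (y == z :> nat) + n.-1 * (x == z :> nat).
  rewrite /wnum /= count_map -sum1_count big_mkcond big_enum /= (bigD1 k) //= eqxx.
  congr (_ + _).
  rewrite (eq_bigr (fun=> (x == z :> nat) : nat)).
    by rewrite sum_nat_const cardC1 card_ord.
  by move=> l /negbTE->; case: eqP.
rewrite !E /ex_label /ex_kind; case: ifP => // _; congr inl; congr inord; congr (_ * _ + _).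
set a := (_ + _); case: (eqVneq a 0) => // a0; case: (eqVneq a 1) => // a1.
case: (eqVneq a n) => // an.
have -> : a == n.-1; last by rewrite orbT.
move: a0 a1 an n3; rewrite /a.
by case: (y == 1 :> nat); case: (x == 1 :> nat); rewrite /= ?muln1 ?muln0; lia.
Qed.
End Existence.

(** * The reduction *)

Lemma code_gt_mem (s : seq nat) x : x \in s -> x < CodeSeq.code s.
Proof.
elim: s => // y s IH; rewrite inE codeE => /orP[/eqP->|/IH lt].
  by apply: leq_trans (ltn_expl y (ltnSn 1)) _; rewrite leq_pmulr.
by apply: leq_trans lt _; apply: leq_trans (leq_pmull _ _); rewrite ?expn_gt0 //; lia.
Qed.

Section Assembly.
Variables (M : machine) (cyc c2 : bool).
Hypotheses (ZN : mZ M != mN M) (sN : mstart M != mN M).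

(** The fixed symbols do not mention the input, so their code can serve as the input without
    circularity. *)
Definition self_input : nat :=
  CodeSeq.code [seq desc_code (labels M) d | d <- fixed_descs M cyc c2].

Lemma self_input_gt : #|label M| < self_input.
Proof.
pose d := mk_desc #|label M| [::] (fun _ : seq (label M) => false).
have d_in : desc_code (labels M) d \in [seq desc_code (labels M) d | d <- fixed_descs M cyc c2].
  by rewrite map_cat mem_cat; apply/orP; left; rewrite !inE eqxx !orbT.
apply: leq_trans (ltnW (code_gt_mem d_in)).
by apply: ltnW; apply: code_gt_mem; rewrite inE eqxx.
Qed.

Lemma self_input_gt0 : 0 < self_input.
Proof. exact: leq_ltn_trans self_input_gt. Qed.

Definition descs := input_desc M self_input_gt0 :: fixed_descs M cyc c2.

Local Notation pad := (self_input - #|label M|).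

(** The homomorphism from A to B must exist whatever the machine does. Label 6 has kind 3 and [hi]
    false; as kind 1 never occurs, the window rules and the lower bound of the input rule are
    vacuous. *)
Definition const_label (a : nat) : label M :=
  match a with
  | 0 => inl ord0
  | 1 => inl (Ordinal (isT : 6 < 8))
  | _ => inr (mZ M, [ffun=> false], false, true)
  end.

Lemma descs_hom : exists h : dA descs -> dB descs pad, homomorphism h.
Proof.
exists (fun a : 'I_3 => inl (const_label a)); apply: const_hom => R; move: R.
pose P (d : rdesc (label M)) := is_true (all (fun c => rP d (mkseq
  (fun i => const_label (inord (nth 0 c i) : 'I_3)) (rar d).+1)) (rcols d)).
suff : allp P descs by move/allp_nth.
have cE k : k < 3 -> const_label (inord k : 'I_3) = const_label k.
  by move=> k3; rewrite inordK.
split.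
  apply/allP => _ /mapP[i _ ->]; set s := mkseq _ _.
  have sE j : j < self_input.+2 -> nth (lab0 M) s j = const_label 0 \/
      nth (lab0 M) s j = const_label 1.
    move=> lj; rewrite !nth_mkseq // /input_col.
    do 2?case: ifP => _; case: (X in nat_of_bool X); rewrite cE //; by [right | left].
  apply/and3P; split.
  - apply/(all_nthP (lab0 M)) => j; rewrite size_mkseq => /sE.
    by case=> ->.
  - by apply/implyP => _; case: (sE self_input) => [|->|->].
  apply/implyP => /forallP /(_ (Ordinal self_input_gt0)).
  by case: (sE 0) => [//|/= ->|/= ->].
apply/allp_cat; split; last first.
  by case: cyc => //; rewrite /P /=; do !split; rewrite ?cE //=.
rewrite /P /=; split; first by rewrite !cE.
split; first by rewrite !cE.
split; first by rewrite !cE.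
split; first by rewrite !cE //= /plus_ok /= ?andbF.
split; first by rewrite !cE.
split; first by rewrite !cE.
split; last by [].
by case: c2; rewrite /= !cE //= ?eqxx // sN ZN.
Qed.

Definition reduction : template := Template descs_hom.

Lemma reduction_code : encodes reduction (template_code self_input).
Proof.
have := encodes_desc (@labels_enum M) descs_hom.
have -> : #|label M| + pad = self_input by rewrite subnKC // ltnW // self_input_gt.
rewrite /template_code; congr (encodes _ (CodeSeq.code [:: _; _; _])).
by rewrite /descs map_cons codeE input_desc_code.
Qed.

Definition has_poly (T : template) (n : nat) : Prop :=
  if cyc then has_cyclic T n else has_wnu T n.

Definition good_arity (n : nat) : bool := if cyc then prime n else 2 < n.

Lemma reduction_exists n : good_arity n ->
  (if c2 then (run M self_input n).1 = mZ M
   else forall c, (run M self_input c).1 <> mN M) ->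
  has_poly reduction n.
Proof.
move=> gn out.
have n1 : 1 < n by move: gn; rewrite /good_arity; case: cyc => [/prime_gt1|/ltnW].
have n_cyc : cyc -> prime n by move=> cT; move: gn; rewrite /good_arity cT.
have n_wnu : ~~ cyc -> 2 < n by move=> /negbTE cF; move: gn; rewrite /good_arity cF.
pose phi := @ex_phi M self_input cyc n.
have hom : homomorphism (A := power (dA descs) n) (B := dB descs pad)
    (fun w => inl (phi w)).
  apply: sat_hom; apply/allp_nth; split; first exact: ex_sat_input.
  apply/allp_cat; split; first exact: ex_sat_common.
  by case: ifP => // cT; exact: ex_sat_cyclic.
rewrite /has_poly; case: ifP => [cT|/negbT cF].
  exists (fun w => inl (phi w)); split=> // w; congr inl.
  exact: ex_phi_cyclic.
exists (fun w => inl (phi w)); split=> // x y i j; congr inl.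
exact: ex_phi_wnu.
Qed.

(** The state after [t] steps is the one shown by a word with [t] twos and no ones, so arity [n]
    tests the times up to [n]. *)
Lemma reduction_forced n : 1 < n -> has_poly reduction n ->
  if c2 then (run M self_input n).1 = mZ M
  else forall t, t <= n -> (run M self_input t).1 <> mN M.
Proof.
move=> n1 H.
have [f Hf Hs] : exists2 f : power (dA descs) n -> dB descs pad, homomorphism f
    & forall i, i < n -> kind (unlab (lab0 M) (f (word n (sing i)))) = 1.
  have sat_of (f : power (dA descs) n -> dB descs pad) : homomorphism f ->
      allp (sat (fun w => unlab (lab0 M) (f w))) (common_descs M cyc c2) /\
      allp (sat (fun w => unlab (lab0 M) (f w))) (if cyc then cyclic_descs M else [::]).
    move=> /(hom_sat (lab0 M)) /allp_nth S; apply/allp_cat.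
    by have : allp (sat (fun w => unlab (lab0 M) (f w))) (fixed_descs M cyc c2) by case: S.
  move: H; rewrite /has_poly; case E : cyc => -[f [Hf Hsym]]; exists f => //;
    have [S1 S2] := sat_of f Hf.
    move: S1 S2; rewrite E; clear - n1 Hsym; case: n n1 f Hsym => // n n1 f Hsym S1 S2.
    apply: (cyc_singles S1 S2) => // w; congr unlab; exact: Hsym.
  move: S1; rewrite E => S1.
  apply: (wnu_singles S1) => // x y i j; congr unlab; exact: Hsym.
have /allp_nth S := hom_sat (lab0 M) Hf.
have Sin : sat (fun w => unlab (lab0 M) (f w)) (input_desc M self_input_gt0) by case: S.
have /allp_cat [Scom _] : allp (sat (fun w => unlab (lab0 M) (f w)))
    (common_descs M cyc c2 ++ (if cyc then cyclic_descs M else [::])) by case: S.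
have twos t : t <= n -> vq (unlab (lab0 M) (f (word n (fun j => if j < t then 2 else 0)))) =
    (run M self_input t).1.
  move=> tn.
  have N2 : num n 2 (fun j => if j < t then 2 else 0) = t.
    rewrite /num (@eq_in_count _ _ (fun j => j < t)) ?sub_count //.
      rewrite -[n in iota 0 n](subnKC tn) iotaD count_cat add0n.
      rewrite (@eq_in_count _ _ predT) ?count_predT ?size_iota.
        rewrite (@eq_in_count _ _ pred0) ?count_pred0 ?addn0 // => j.
        by rewrite mem_iota => /andP[tj _]; rewrite ltnNge tj.
      by move=> j; rewrite mem_iota add0n => /andP[_ ->].
    by move=> j _; case: ifP.
  have N1 : num n 1 (fun j => if j < t then 2 else 0) = 0.
    by apply: num_none => j _; case: ifP.
  have [|_ ->] // := forced_run Scom Sin Hs _ N2.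
  by move=> j _; case: ifP.
case: Scom => _ [_ [_ [_ [_ [_ [Sout _]]]]]].
case: c2 Sout => Sout.
  rewrite -twos //; have := Sout (fun=> [:: 2]) (fun _ _ => isT); rewrite /= => /eqP <-.
  by congr (vq (unlab _ (f _))); apply: eq_word => j ->.
move=> t tn; rewrite -twos //; apply/eqP.
apply: (Sout (fun j => [:: if j < t then 2 else 0])) => j _.
by case: ifP.
Qed.
End Assembly.

(** The machine first applies [g] to its input and then runs [f]. As [g] does not depend on the
    machine, the latter is fixed before the template built from it, and still [f] receives the code
    of that template. *)
Lemma decider_outcome (f : recf 1) (Q : template -> Prop) cyc c2 :
  decides f lhs_at_most_3 Q ->
  exists M, exists (ZN : mZ M != mN M) (sN : mstart M != mN M),
    let T := reduction cyc c2 ZN sN in let m := self_input M cyc c2 in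
    [/\ absorbing (mZ M), absorbing (mN M)
      & (Q T /\ exists t, (run M m t).1 = mN M) \/
        (~ Q T /\ exists t, (run M m t).1 = mZ M)].
Proof.
move=> Hf; have [g Hg] := computable_template_code.
have [M [ZN sN aZ aN HM]] := recf_machine (Comp f (fun _ : 'I_1 => g)).
exists M, ZN, sN; split=> //.
have [|b [ev bQ]] := Hf (reduction cyc c2 ZN sN) _ _ (reduction_code cyc c2 ZN sN).
  by rewrite /lhs_at_most_3 card_ord.
have [|t Et] := HM (self_input M cyc c2) b.
  exists [tuple template_code (self_input M cyc c2)]; split=> // i.
  by have := Hg [tuple self_input M cyc c2]; rewrite ord1.
case: b bQ {ev} Et => /= bQ Et; [left | right]; split; try by exists t.
  exact/bQ.
by move/bQ.
Qed.

(** Answer yes leads to [mN], which rules out all large arities; answer no keeps the run out of [mN]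
    forever, which yields all good arities. Both answers are wrong. *)
Lemma undecidable_all cyc (Q : template -> Prop) :
  (forall T, (forall n, good_arity cyc n -> has_poly cyc T n) -> Q T) ->
  (forall T t, (forall n, t <= n -> 1 < n -> ~ has_poly cyc T n) -> ~ Q T) ->
  undecidable lhs_at_most_3 Q.
Proof.
move=> Qall Qnone [f /(decider_outcome cyc false)].
move=> [M [ZN [sN [aZ aN [[QT [t Et]]|[nQT [t Et]]]]]]].
  apply: (Qnone _ t _ QT) => n tn n1 /(reduction_forced n1) /(_ t tn); exact.
apply: nQT; apply: Qall => n gn; apply: reduction_exists => // c Ec.
move/eqP: (ZN); apply; have [ct|tc] := leqP c t.
  by rewrite -Et (run_absorb aN Ec).
by rewrite -Ec (run_absorb aZ Et (ltnW tc)).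
Qed.

(** Answer yes means that [mZ] is never entered, so no arity above 1 occurs; answer no means that
    [mZ] is reached, so all good arities from that time on occur. *)
Lemma undecidable_some cyc (Q : template -> Prop) :
  (forall T t, (forall n, t <= n -> good_arity cyc n -> has_poly cyc T n) -> Q T) ->
  (forall T, (forall n, 1 < n -> ~ has_poly cyc T n) -> ~ Q T) ->
  undecidable lhs_at_most_3 Q.
Proof.
move=> Qlarge Qnone [f /(decider_outcome cyc true)].
move=> [M [ZN [sN [aZ aN [[QT [t Et]]|[nQT [t Et]]]]]]].
  apply: (Qnone _ _ QT) => n n1 /(reduction_forced n1) Ec.
  move/eqP: (ZN); apply; have [ct|tc] := leqP n t.
    by rewrite -Et (run_absorb aZ Ec).
  by rewrite -Ec (run_absorb aN Et (ltnW tc)).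
apply: nQT; apply: (Qlarge _ t) => n tn gn; apply: reduction_exists => //.
exact: run_absorb Et tn.
Qed.

Lemma seq_bound (s : seq nat) : exists b, forall x, x \in s -> x <= b.
Proof.
elim: s => [|y s [b Hb]]; first by exists 0.
by exists (maxn y b) => x; rewrite inE leq_max => /orP[/eqP->|/Hb->]; rewrite ?leqnn ?orbT.
Qed.

Lemma good_above cyc b : exists n, [/\ b < n, 1 < n & good_arity cyc n].
Proof.
case: cyc; last by exists b.+3; split=> //=; lia.
by have [p bp pp] := prime_above b; exists p; split=> //; exact: prime_gt1.
Qed.

Lemma undecidable_every cyc : undecidable lhs_at_most_3
  (fun T => forall n, good_arity cyc n -> has_poly cyc T n).
Proof.
apply: (undecidable_all (cyc := cyc)) => // T t none all.
have [n [tn n1 gn]] := good_above cyc t.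
exact: none (ltnW tn) n1 (all n gn).
Qed.

Lemma undecidable_almost_every cyc : undecidable lhs_at_most_3
  (fun T => exists s : seq nat, forall n, good_arity cyc n -> n \notin s -> has_poly cyc T n).
Proof.
apply: (undecidable_all (cyc := cyc)) => [T all|T t none [s all]].
  by exists [::] => n gn _; exact: all.
have [b Hb] := seq_bound s; have [n [bn n1 gn]] := good_above cyc (maxn b t).
apply: (none n) => //; first by lia.
by apply: all => //; apply/negP => /Hb; lia.
Qed.

Lemma undecidable_infinitely_many cyc : undecidable lhs_at_most_3
  (fun T => forall s : seq nat, exists n, [/\ good_arity cyc n, n \notin s & has_poly cyc T n]).
Proof.
apply: (undecidable_all (cyc := cyc)) => [T all s|T t none inf].
  have [b Hb] := seq_bound s; have [n [bn n1 gn]] := good_above cyc b.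
  exists n; split=> //; last exact: all.
  by apply/negP => /Hb; lia.
(* Excluding 0 to [t + 1] leaves an arity above both [t] and 1. *)
have [n [gn ns Hn]] := inf (iota 0 t.+2).
rewrite mem_iota in ns.
by apply: (none n) => //; lia.
Qed.

Theorem theorem1p2 :
  [/\ undecidable lhs_at_most_3
        (fun T => forall p : nat, prime p -> has_cyclic T p),
      undecidable lhs_at_most_3
        (fun T => exists n : nat, 2 <= n /\ has_cyclic T n),
      undecidable lhs_at_most_3
        (fun T => exists s : seq nat, forall p : nat,
           prime p -> p \notin s -> has_cyclic T p)
    & undecidable lhs_at_most_3
        (fun T => forall s : seq nat, exists p : nat,
           [/\ prime p, p \notin s & has_cyclic T p])] /\
  [/\ undecidable lhs_at_most_3
        (fun T => forall k : nat, 3 <= k -> has_wnu T k),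
      undecidable lhs_at_most_3
        (fun T => exists k : nat, 3 <= k /\ has_wnu T k),
      undecidable lhs_at_most_3
        (fun T => exists s : seq nat, forall k : nat,
           3 <= k -> k \notin s -> has_wnu T k)
    & undecidable lhs_at_most_3
        (fun T => forall s : seq nat, exists k : nat,
           [/\ 3 <= k, k \notin s & has_wnu T k])].
Proof.
split; split.
- exact: (@undecidable_every true).
- apply: (undecidable_some (cyc := true)) => [T t H|T none [n [n1 Hn]]].
    have [n [tn n1 gn]] := good_above true t.
    by exists n; split=> //; exact: H (ltnW tn) gn.
  exact: none n1 Hn.
- exact: (@undecidable_almost_every true).
- exact: (@undecidable_infinitely_many true).
- exact: (@undecidable_every false).
- apply: (undecidable_some (cyc := false)) => [T t H|T none [n [n1 Hn]]].
    have [n [tn n1 gn]] := good_above false t.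
    by exists n; split=> //; exact: H (ltnW tn) gn.
  exact: none (ltnW n1) Hn.
- exact: (@undecidable_almost_every false).
- exact: (@undecidable_infinitely_many false).
Qed.
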